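(* Let $H$ be any graph on $h$ vertices with maximum degree $\Delta\ge 2$, and let $G$ be a random $n$-lift of $H$. Then for all $n$ sufficiently large: with probability at least $1-n^{-2\sqrt{\Delta}}$ we have $\lambda^*(G)\le 430656\sqrt{\Delta}$; and with probability at least $1-n^{-h\Delta}$, $G$ contains an induced subgraph $G'$ with at most $h\Delta$ vertices such that $\lambda^*(G)\le 1189248\,\lambda(G')$.
   Context: Let $H$ be a graph with vertex set $[h]$. An $n$-lift $G$ of $H$ has vertex set $\{(i,j): i\in[h], j\in[n]\}$; the set $V_i=\{(i,j):j\in[n]\}$ is the fibre of $i$. For each edge $ii'$ of $H$ a perfect matching between $V_i$ and $V_{i'}$ is placed, and these are the only edges of $G$. A random $n$-lift is obtained by choosing these matchings independently and uniformly at random. Let $M$ be the adjacency matrix of $G$. The eigenvalues of $M$ restricted to the ($M$-invariant) subspace of vectors $x$ with $\sum_{v\in V_i}x_v=0$ for all $i$ are the new eigenvalues; $\lambda^*(G)$ is the largest absolute value of a new eigenvalue. For a graph $F$, $\lambda(F)$ is the largest eigenvalue of its adjacency matrix. *)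

(* Defs.v *)
From Stdlib Require Import Reals ClassicalEpsilon.
From HB Require Import structures.
From mathcomp Require Import all_boot all_fingroup.

Set Implicit Arguments.
Unset Strict Implicit.
Unset Printing Implicit Defensive.

Definition maxdeg (h : nat) (H : rel 'I_h) : nat :=
  \max_(i : 'I_h) #|[set j | H i j]|.

(* The sample space of n-lifts: for each ordered pair (i,i') of base vertices
   a permutation of 'I_n. Only pairs (i,i') with H i i' and i < i' are used:
   for such an edge, (i,j) is matched to (i', s(i,i') j). Choosing the whole
   function uniformly is the same as choosing the matchings of the edges
   independently and uniformly (the unused coordinates are irrelevant). *)
Definition lift_space (h n : nat) := {ffun 'I_h * 'I_h -> {perm 'I_n}}.

Definition lift_adj (h n : nat) (H : rel 'I_h) (s : lift_space h n)
  : rel ('I_h * 'I_n) :=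
  fun u v => H u.1 v.1 &&
    (if (u.1 < v.1)%N then s (u.1, v.1) u.2 == v.2
     else s (v.1, u.1) v.2 == u.2).

Definition adjR (T : finType) (e : rel T) (u v : T) : R :=
  if e u v then R1 else R0.

Definition is_eig_induced (T : finType) (e : rel T) (S : {set T}) (mu : R)
  : Prop :=
  exists x : T -> R,
    (forall u, u \notin S -> x u = R0) /\
    (exists u, u \in S /\ x u <> R0) /\
    (forall u, u \in S ->
       \big[Rplus/R0]_(v in S) Rmult (adjR e u v) (x v) = Rmult mu (x u)).

Definition is_largest_eig (T : finType) (e : rel T) (S : {set T}) (mu : R)
  : Prop :=
  is_eig_induced e S mu /\ (forall mu', is_eig_induced e S mu' -> Rle mu' mu).

(* l is a new eigenvalue of the lift: an eigenvalue of the adjacency matrix M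
   restricted to the M-invariant subspace of vectors summing to 0 on each fibre. *)
Definition is_new_eig (h n : nat) (e : rel ('I_h * 'I_n)) (l : R) : Prop :=
  exists x : 'I_h * 'I_n -> R,
    (exists u, x u <> R0) /\
    (forall i : 'I_h, \big[Rplus/R0]_(j : 'I_n) x (i, j) = R0) /\
    (forall u, \big[Rplus/R0]_(v : 'I_h * 'I_n) Rmult (adjR e u v) (x v)
               = Rmult l (x u)).

Definition lambda_star_le (h n : nat) (e : rel ('I_h * 'I_n)) (c : R) : Prop :=
  forall l, is_new_eig e l -> Rle (Rabs l) c.

Definition prob (T : finType) (P : T -> Prop) : R :=
  Rdiv (INR #|[set x | if excluded_middle_informative (P x) then true else false]|)
       (INR #|T|).

(* Main.v *)
Require Import Defs.
From Stdlib Require Import Reals.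
From HB Require Import structures.
From mathcomp Require Import all_boot all_fingroup all_order all_algebra.
From mathcomp Require Import zify ring lra.
From mathcomp Require Import boolp reals.
From mathcomp Require Import Rstruct.
From mathcomp.analysis Require Import sequences exp.
Set Implicit Arguments. Unset Strict Implicit. Unset Printing Implicit Defensive.
Import Order.TTheory GRing.Theory Num.Theory.

(* Let [M] be the adjacency matrix of the lift, [M'] its difference with the expectation
   [H / n], and [Delta = maxdeg H]; on vectors balanced on every fibre the two quadratic forms
   agree. Normalise an eigenvector [x] by [sum x^2 = h n]. Each fibre [i] gets a base level
   [d i], with [4 ^ d i] about the mean of [x^2] on the fibre, and a vertex [u] the least height
   [k u] such that [|x u| <= 2 ^ (d i + k u)]. By linearity in each factor, [|x^T M x|] is at
   most [y^T M' z] for two vectors with [|y u| = |z u| = 2 ^ (d i + k u)], so that only the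
   levels and the signs remain random choices for a union bound.

   Pairs whose levels differ by more than [log2 (sqrt Delta)] contribute [O(sqrt Delta)] because
   degrees are at most [Delta]. The other pairs with at least one bounded level are divided into
   groups according to the lower level [a] and a dyadic parameter [2 ^ r], comparable with the
   larger of the heights, the height of the upper vertex being divided by the ratio of the two
   values. Every group has its own Chernoff bound, with exponential parameter
   proportional to [2 ^ r / (4 ^ a sqrt Delta)]. Describing the vertices that matter for a group
   costs [4 (k u + 1)] each and almost nothing for the others; both this cost and the second
   order term of the moment generating function, divided by the parameter, are summable over the
   groups with total [O(sqrt Delta) h n]. No heavy/light distinction is needed.

   The vertices of large level form a set [L] of at most [eps n] vertices. With probability
   [1 - n ^ - (Q + 1)] every such set [S] spans at most [10 #|S| + O(Q)] edges, so peeling off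
   vertices of degree less than 32 leaves a core with at most [Q] vertices, and the peeled part
   contributes [O(sqrt Delta)]. For [Q = 2 Delta] the core has [O(Delta)] edges, hence norm
   [O(sqrt Delta)]; for [Q = h Delta] the dense subgraph is the core or a star. *)

(** * Sums over permutations *)

Section PermutationAverages.
Variable R : realType.
Local Open Scope ring_scope.
Implicit Types n : nat.

(** Conditioning on the image [m] of row [i] leaves a permutation of the remaining rows and columns;
    both inductions on permutation sums below start from this. *)
Lemma sum_lift_perm n (i : 'I_n.+1) (F : 'S_n.+1 -> R) :
  \sum_s F s = \sum_m \sum_(t : 'S_n) F (lift_perm i m t).
Proof.
pose L (p : 'I_n.+1 * 'S_n) := lift_perm i p.1 p.2.
have injL : injective L.
  case=> [m t] [m' t'] /permP eqL.
  have := eqL i; rewrite !lift_perm_id => /= eq_m; subst m'.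
  congr (_, _); apply/permP => k.
  by have := eqL (lift i k); rewrite !lift_perm_lift => /lift_inj.
have bijL : bijective L.
  apply: inj_card_bij injL _.
  by rewrite card_prod !card_Sn card_ord factS.
by rewrite (reindex L (onW_bij _ bijL)) /= pair_bigA.
Qed.

Lemma big_lift_perm n (T : Type) (op : SemiGroup.com_law T) (idx : T) (i m : 'I_n.+1) (t : 'S_n)
    (G : 'I_n.+1 -> 'I_n.+1 -> T) :
  \big[op/idx]_k G k (lift_perm i m t k)
    = op (G i m) (\big[op/idx]_k G (lift i k) (lift m (t k))).
Proof.
rewrite (bigD1_ord i) //= lift_perm_id; congr (op _ _).
by apply: eq_bigr => k _; rewrite lift_perm_lift.
Qed.

(** Everything comes from [expR y * (1 - y) <= 1]. For [x <= 0] take [y = x] and use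
    [(1 + x + x^2) (1 - x) = 1 - x^3 >= 1]; for [x > 0] take [y = x / 2] and square. *)
Lemma expR_le_quadratic (x : R) : `|x| <= 1 / 4%:R -> expR x <= 1 + x + x ^+ 2.
Proof.
rewrite ler_norml => /andP[xge xle].
have h (y : R) : expR y * (1 - y) <= 1.
  rewrite -[leRHS](expRxMexpNx_1 y) ler_wpM2l ?expR_ge0 //.
  exact: expR_ge1Dx (- y).
have [x0|x0] := leP x 0.
  have hp : 0 < expR x := expR_gt0 x.
  have hx := h x.
  have : 1 <= (1 + x + x ^+ 2) * (1 - x) by nra.
  have : 0 < 1 - x by lra.
  by move=> ? ?; rewrite -(ler_pM2r (x := 1 - x)) //; lra.
have hx := h (x / 2%:R).
have -> : x = x / 2%:R + x / 2%:R by field.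
rewrite expRD.
set E := expR _ in hx *.
have E0 : 0 < E := expR_gt0 _.
have hE : (E * (1 - x / 2%:R)) ^+ 2 <= 1.
  by rewrite expr_le1 // mulr_ge0 ?ltW //; lra.
have : 1 <= (1 + x + x ^+ 2) * (1 - x / 2%:R) ^+ 2.
  have -> : (1 + x + x ^+ 2) * (1 - x / 2%:R) ^+ 2
     = 1 + x ^+ 2 / 4%:R * (1 - 3%:R * x + x ^+ 2) by field.
  by rewrite lerDl mulr_ge0 ?divr_ge0 ?sqr_ge0 //; nra.
have p0 : 0 < (1 - x / 2%:R) ^+ 2 by rewrite exprn_gt0 //; lra.
move=> h1; rewrite -(ler_pM2r p0) -expr2 -exprMn.
have -> : x / 2%:R + x / 2%:R = x by field.
exact: le_trans hE h1.
Qed.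

Lemma sumr_sqr_le n (F : 'I_n -> R) : (\sum_k F k) ^+ 2 <= n%:R * \sum_k F k ^+ 2.
Proof.
have : 0 <= \sum_k \sum_l (F k - F l) ^+ 2.
  by apply: sumr_ge0 => k _; apply: sumr_ge0 => l _; apply: sqr_ge0.
under eq_bigr => k _ do under eq_bigr => l _ do rewrite sqrrB.
under eq_bigr => k _ do rewrite big_split /= big_split /= sumr_const card_ord.
rewrite big_split /= big_split /= sumr_const card_ord.
have -> : \sum_(k < n) \sum_(l < n) - (F k * F l *+ 2) = - (\sum_k F k) ^+ 2 *+ 2.
  rewrite expr2 mulr_suml -sumrN -sumrMnl; apply: eq_bigr => k _.
  rewrite mulr_sumr -sumrN -sumrMnl; apply: eq_bigr => l _.
  by rewrite mulNrn.
rewrite sumrMnl -mulr_natl; set A := \sum_k _; set B := (_ ^+ 2).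
by move=> ?; nra.
Qed.


(** One column of the induction in [perm_prod_small]: [f] is the entry of the removed row, [z] the
    drop of the exponent caused by removing that column, [q] the mean square of the rest of the
    column. The cross term is split by [- f z <= f^2 / 2 + z^2 / 2]. *)
Lemma perm_prod_step (f z q : R) : `|f| <= 1 / 10%:R -> `|z| <= 3%:R / 20%:R ->
  z ^+ 2 <= 5%:R / 2%:R * q ->
  (1 + f) * expR (- z) <= 1 + f - z + f ^+ 2 / 2%:R + 4%:R * q.
Proof.
move=> hf hz hq.
have hE : expR (- z) <= 1 + (- z) + (- z) ^+ 2.
  by apply: expR_le_quadratic; rewrite normrN; lra.
move: hf hz; rewrite !ler_norml => /andP[f1 f2] /andP[z1 z2].
have : (1 + f) * expR (- z) <= (1 + f) * (1 + (- z) + (- z) ^+ 2).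
  by rewrite ler_wpM2l //; lra.
have : - (f * z) <= f ^+ 2 / 2%:R + z ^+ 2 / 2%:R.
  by have := sqr_ge0 (f + z); rewrite sqrrD; lra.
have : f * z ^+ 2 <= z ^+ 2 / 10%:R.
  by have := sqr_ge0 z; nra.
rewrite sqrrN; nra.
Qed.

(* Expand along the row with the largest sum of squares: that sum dominates the average over the
   other rows, which absorbs the second order error coming from the random removed column. *)
Lemma perm_prod_small n (f : 'I_n -> 'I_n -> R) :
  (forall k l, `|f k l| <= 1 / 10%:R) ->
  \sum_(s : 'S_n) \prod_k (1 + f k (s k))
    <= n`!%:R * expR ((\sum_k \sum_l f k l + 5%:R * \sum_k \sum_l f k l ^+ 2) / n%:R).
Proof.
elim: n f => [|n IH] f hf.
  under eq_bigr => s _ do rewrite big_ord0.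
  by rewrite !big_ord0 mulr0 addr0 mul0r expR0 mulr1 sumr_const card_Sn.
pose rowq k := \sum_l f k l ^+ 2.
have [i hi] : exists i, forall j, rowq j <= rowq i.
  by case: (@Order.TotalTheory.arg_maxP _ _ 'I_n.+1 ord0 xpredT rowq isT) => i _ H; exists i => j; apply: H.
rewrite (sum_lift_perm i).
pose W := \sum_k \sum_l f (lift i k) l.
pose Q := \sum_k rowq (lift i k).
pose c m := \sum_k f (lift i k) m.
pose q m := \sum_k f (lift i k) m ^+ 2.
pose z m := (c m + 5%:R * q m) / n%:R.
have q0 m : 0 <= q m by apply: sumr_ge0 => k _; apply: sqr_ge0.
have f2 k l : f k l ^+ 2 <= 1 / 100%:R.
  have := hf k l; rewrite ler_norml => /andP[? ?].
  by nra.
have sc : \sum_m c m = W by rewrite /c exchange_big.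
have sq : \sum_m q m = Q by rewrite /q exchange_big.
have hW m : \sum_k \sum_l f (lift i k) (lift m l) = W - c m.
  rewrite /W /c -sumrB; apply: eq_bigr => k _.
  by rewrite [in RHS](bigD1_ord m) //= addrAC subrr add0r.
have hQ m : \sum_k \sum_l f (lift i k) (lift m l) ^+ 2 = Q - q m.
  rewrite /Q /q -sumrB; apply: eq_bigr => k _.
  by rewrite /rowq [in RHS](bigD1_ord m) //= addrAC subrr add0r.
have n0 : 0 <= n%:R :> R by [].
have absz m : `|z m| <= 3%:R / 20%:R.
  case: (posnP n) => [n00|npos].
    by rewrite /z n00 invr0 mulr0 normr0; lra.
  have np : 0 < n%:R :> R by rewrite ltr0n.
  have h1 : `|c m| <= n%:R * (1 / 10%:R).
    apply: le_trans (ler_norm_sum _ _ _) _.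
    rewrite -[n in leRHS]card_ord mulr_natl -sumr_const.
    by apply: ler_sum => k _; apply: hf.
  have h2 : q m <= n%:R * (1 / 100%:R).
    rewrite -[n in leRHS]card_ord mulr_natl -sumr_const.
    by apply: ler_sum => k _; apply: f2.
  rewrite /z normrM normfV (ger0_norm n0) ler_pdivrMr //.
  apply: le_trans (ler_normD _ _) _.
  rewrite (@ger0_norm _ (5%:R * q m)) ?mulr_ge0 //.
  by lra.
(* By Cauchy-Schwarz [c^2 <= n q], and [q <= n / 100], so
   [(c + 5 q)^2 <= 2 c^2 + 50 q^2 <= 5/2 n q]. *)
have z2 m : z m ^+ 2 <= 5%:R / 2%:R * (q m / n%:R).
  case: (posnP n) => [n00|npos].
    by rewrite /z n00 invr0 !mulr0 expr0n.
  have np : 0 < n%:R :> R by rewrite ltr0n.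
  have h1 := sumr_sqr_le (fun k => f (lift i k) m).
  rewrite -/(c m) -/(q m) in h1.
  have h2 : q m <= n%:R * (1 / 100%:R).
    rewrite -[n in leRHS]card_ord mulr_natl -sumr_const.
    by apply: ler_sum => k _; apply: f2.
  rewrite /z expr_div_n ler_pdivrMr ?exprn_gt0 //.
  have -> : 5%:R / 2%:R * (q m / n%:R) * n%:R ^+ 2 = 5%:R / 2%:R * q m * n%:R.
    by field; rewrite gt_eqF.
  have h3 := sqr_ge0 (c m - 5%:R * q m).
  have h4 : q m ^+ 2 <= q m * (n%:R * (1 / 100%:R)) by rewrite expr2 ler_wpM2l.
  by rewrite sqrrB sqrrD in h3 *; nra.
have step : \sum_m \sum_(t : 'S_n) \prod_k (1 + f k (lift_perm i m t k))
   <= n`!%:R * expR ((W + 5%:R * Q) / n%:R) *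
      \sum_m (1 + f i m - z m + f i m ^+ 2 / 2%:R + 4%:R * (q m / n%:R)).
  rewrite mulr_sumr; apply: ler_sum => m _.
  under eq_bigr => t _ do rewrite (big_lift_perm _ _ i m t (fun k l => 1 + f k l)).
  rewrite -mulr_sumr.
  have f1 : 0 <= 1 + f i m.
    by have := hf i m; rewrite ler_norml => /andP[? ?]; lra.
  have := IH (fun k l => f (lift i k) (lift m l)) (fun k l => hf _ _).
  rewrite hW hQ => /(ler_wpM2l f1) h.
  apply: le_trans h _.
  have -> : (W - c m + 5%:R * (Q - q m)) / n%:R = (W + 5%:R * Q) / n%:R + - z m.
    by rewrite /z; ring.
  rewrite expRD; set E1 := expR (_ / _); set E2 := expR (- _); set N := n`!%:R.
  have -> : (1 + f i m) * (N * (E1 * E2)) = N * E1 * ((1 + f i m) * E2) by ring.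
  rewrite ler_wpM2l ?mulr_ge0 ?expR_ge0 //.
  exact: perm_prod_step.
apply: le_trans step _.
rewrite factS natrM.
set E1 := expR (_ / _); set r := \sum_l f i l.
have -> : \sum_k \sum_l f k l = r + W by rewrite (bigD1_ord i).
have -> : \sum_k \sum_l f k l ^+ 2 = rowq i + Q by rewrite (bigD1_ord i).
have -> : \sum_m (1 + f i m - z m + f i m ^+ 2 / 2%:R + 4%:R * (q m / n%:R))
   = n.+1%:R * (1 + (r - (W + 5%:R * Q) / n%:R + rowq i / 2%:R + 4%:R * (Q / n%:R)) / n.+1%:R).
  rewrite !big_split /= sumr_const card_ord sumrN.
  rewrite -/r -!mulr_suml -/(rowq i) -mulr_sumr -!mulr_suml sq big_split /= -mulr_sumr sc sq.
  have e (T : R) : n.+1%:R * (1 + T / n.+1%:R) = n.+1%:R + T.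
    by rewrite mulrDr mulr1 mulrCA divff ?mulr1 ?pnatr_eq0.
  rewrite e; ring.
set N := n`!%:R; set N1 := n.+1%:R; set T := (_ / N1).
have -> : N * E1 * (N1 * (1 + T)) = N1 * N * (E1 * (1 + T)) by ring.
rewrite ler_wpM2l ?mulr_ge0 //.
apply: le_trans (ler_wpM2l (expR_ge0 _) (expR_ge1Dx _)) _.
rewrite -expRD ler_expR.
(* After multiplication by [n + 1] the two terms [(W + 5 Q) / n] cancel. What remains is
   [rowq i / 2 + 4 Q / n <= 5 rowq i], where the maximality of row [i] enters and which fixes the
   constant 5. *)
have Qn : Q <= n%:R * rowq i.
  rewrite -[n in leRHS]card_ord mulr_natl -sumr_const.
  by apply: ler_sum => k _; apply: hi.
have ri0 : 0 <= rowq i by apply: sumr_ge0 => k _; apply: sqr_ge0.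
have np1 : 0 < n.+1%:R :> R by rewrite ltr0n.
rewrite ler_pdivlMr // mulrDl divfK ?gt_eqF //.
case: (posnP n) => [n00|npos].
  have W0 : W = 0 by rewrite /W; clear -n00; subst n; rewrite big_ord0.
  have Q0 : Q = 0 by rewrite /Q; clear -n00; subst n; rewrite big_ord0.
  by rewrite W0 Q0 !mulr0 addr0 !mul0r; lra.
have np : 0 < n%:R :> R by rewrite ltr0n.
have -> : (W + 5%:R * Q) / n%:R * n.+1%:R = W + 5%:R * Q + (W + 5%:R * Q) / n%:R.
  by rewrite -natr1; field; rewrite gt_eqF.
have : Q / n%:R <= rowq i by rewrite ler_pdivrMr // mulrC.
by lra.
Qed.

(* With at most [n - p] active rows, a value is chosen among at least [p + 1] remaining ones at
   each of these rows. *)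
Lemma perm_prod_rows n p (A : {set 'I_n}) (f : 'I_n -> 'I_n -> R) :
  (#|A| + p <= n)%N -> (forall k l, 0 <= f k l) -> (forall k l, k \notin A -> f k l = 0) ->
  \sum_(s : 'S_n) \prod_k (1 + f k (s k))
    <= n`!%:R * expR ((\sum_k \sum_l f k l) / p.+1%:R).
Proof.
elim: n p A f => [|n IH] p A f cA f0 fA.
  under eq_bigr => s _ do rewrite big_ord0.
  by rewrite !big_ord0 mul0r expR0 mulr1 sumr_const card_Sn.
have [A0|[i iA]] := set_0Vmem A.
  have f00 k l : f k l = 0 by apply: fA; rewrite A0 inE.
  under eq_bigr => s _ do under eq_bigr => k _ do rewrite f00 addr0.
  under eq_bigr => s _ do rewrite big1_eq.
  rewrite sumr_const card_Sn ler_peMr //.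
  rewrite -[leLHS]expR0 ler_expR divr_ge0 //.
  by apply: sumr_ge0 => k _; apply: sumr_ge0.
rewrite (sum_lift_perm i).
pose B := [set k | lift i k \in A].
have cB : (#|B| + p <= n)%N.
  have -> : #|B| = #|A :\ i|.
    rewrite -(card_imset _ (@lift_inj _ i)); apply: eq_card => k.
    rewrite !inE; apply/imsetP/andP => [[k' + ->]|[ki kA]].
      by rewrite inE => ?; rewrite eq_sym neq_lift.
    rewrite eq_sym in ki; case/unlift_some: ki => k' e _.
    by exists k' => //; rewrite inE -e.
  by move: cA; rewrite (cardsD1 i) iA; lia.
pose W := \sum_k \sum_l f (lift i k) l.
have step m : \sum_(t : 'S_n) \prod_k (1 + f k (lift_perm i m t k))
   <= (1 + f i m) * (n`!%:R * expR (W / p.+1%:R)).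
  under eq_bigr => t _ do rewrite (big_lift_perm _ _ i m t (fun k l => 1 + f k l)).
  rewrite -mulr_sumr ler_wpM2l ?addr_ge0 //.
  have h := IH p B (fun k l => f (lift i k) (lift m l)) cB (fun _ _ => f0 _ _).
  apply: le_trans (h _) _ => [k l|]; first by rewrite inE => ?; apply: fA.
  rewrite ler_wpM2l // ler_expR ler_wpM2r ?invr_ge0 //.
  apply: ler_sum => k _; rewrite [leRHS](bigD1_ord m) //=.
  by rewrite lerDr.
apply: le_trans (ler_sum _ (fun m _ => step m)) _.
rewrite -mulr_suml big_split /= sumr_const card_ord.
have -> : \sum_k \sum_l f k l = \sum_l f i l + W by rewrite (bigD1_ord i).
set r := \sum_l f i l.
rewrite [(r + W) / _]mulrDl expRD factS natrM.
have r0 : 0 <= r by apply: sumr_ge0.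
have h1 : n.+1%:R + r <= n.+1%:R * expR (r / p.+1%:R).
  apply: le_trans (ler_wpM2l _ (expR_ge1Dx _)); rewrite ?ler0n //.
  rewrite mulrDr mulr1 lerD2l mulrCA ler_peMr //.
  rewrite ler_pdivlMr ?ltr0n // mul1r ler_nat; lia.
set E := expR (W / _); set E' := expR _ in h1 *.
have -> : n.+1%:R * n`!%:R * (E' * E) = n.+1%:R * E' * (n`!%:R * E) by ring.
by rewrite ler_wpM2r ?mulr_ge0 ?expR_ge0.
Qed.

End PermutationAverages.

(** * Moment generating function of a permutation statistic *)

Section PermutationMgf.
Variable R : realType.
Local Open Scope ring_scope.

(** By AM-GM [expR (a + b) <= (expR (2 a) + expR (2 b)) / 2]: dependent parts of an exponent can be
    treated separately at the price of doubling each. *)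
Lemma expR_sum_split (T : finType) (a b : T -> R) :
  \sum_t expR (2%:R * a t) <= #|T|%:R -> \sum_t expR (2%:R * b t) <= #|T|%:R ->
  \sum_t expR (a t + b t) <= #|T|%:R.
Proof.
move=> ha hb.
have h t : expR (a t + b t) <= (expR (2%:R * a t) + expR (2%:R * b t)) / 2%:R.
  rewrite !expRM_natl expRD.
  by have := sqr_ge0 (expR (a t) - expR (b t)); rewrite sqrrB; lra.
apply: le_trans (ler_sum _ (fun t _ => h t)) _.
by rewrite -mulr_suml big_split /=; lra.
Qed.

(** This is [perm_prod_small] for [f = expR x - 1]. Here [f <= x + x^2] and
    [5 f^2 <= 5 (13/12)^2 x^2 < 6 x^2], whence the 7. *)
Lemma perm_mgf_small n (x : 'I_n -> 'I_n -> R) :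
  (forall k l, `|x k l| <= 1 / 12%:R) ->
  \sum_(s : 'S_n) expR (\sum_k x k (s k))
    <= n`!%:R * expR ((\sum_k \sum_l (x k l + 7%:R * x k l ^+ 2)) / n%:R).
Proof.
move=> hx.
have hf k l : [/\ x k l <= expR (x k l) - 1, expR (x k l) - 1 <= x k l + x k l ^+ 2
    & `|expR (x k l) - 1| <= 13%:R / 12%:R * `|x k l| ].
  have h1 := expR_ge1Dx (x k l).
  have h2 : expR (x k l) <= 1 + x k l + x k l ^+ 2.
    by apply: expR_le_quadratic; apply: le_trans (hx k l) _; lra.
  have h3 : x k l ^+ 2 <= 1 / 12%:R * `|x k l|.
    by rewrite -(real_normK (num_real (x k l))) expr2 ler_wpM2r.
  split; [lra | lra | ].
  have := ler_norm (x k l); have := ler_norm (- x k l); rewrite normrN => ? ?.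
  by rewrite ler_norml; apply/andP; split; lra.
have small k l : `|expR (x k l) - 1| <= 1 / 10%:R.
  by have [_ _ h] := hf k l; apply: le_trans h _; have := hx k l; lra.
have := perm_prod_small small.
under eq_bigr => s _ do under eq_bigr => k _ do rewrite addrCA subrr addr0.
under eq_bigr => s _ do rewrite -expR_sum.
move=> h; apply: le_trans h _.
rewrite ler_wpM2l // ler_expR ler_wpM2r ?invr_ge0 //.
rewrite mulr_sumr -big_split; apply: ler_sum => k _ /=.
rewrite mulr_sumr -big_split; apply: ler_sum => l _ /=.
have [h1 h2 h3] := hf k l.
have : (expR (x k l) - 1) ^+ 2 <= (13%:R / 12%:R * `|x k l|) ^+ 2.
  rewrite -(real_normK (num_real (expR (x k l) - 1))) lerXn2r ?nnegrE //.
  by rewrite mulr_ge0 // divr_ge0.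
by rewrite exprMn real_normK ?num_real //; lra.
Qed.

(** [perm_prod_rows] loses only a factor 2 in the exponent when at most about half of the rows are
    active. The rows are therefore cut into two halves, recombined by [expR_sum_split]; this
    produces the [2 G]. *)
Lemma perm_mgf_large n (G : 'I_n -> 'I_n -> R) : (forall k l, 0 <= G k l) ->
  \sum_(s : 'S_n) expR (\sum_k G k (s k))
    <= n`!%:R * expR ((\sum_k \sum_l (expR (2%:R * G k l) - 1)) / n%:R).
Proof.
move=> G0; have [n0|npos] := posnP n.
  by subst n; rewrite !big_ord0 mul0r expR0 mulr1; under eq_bigr => s _ do
    rewrite big_ord0 expR0; rewrite sumr_const card_Sn.
have np : 0 < n%:R :> R by rewrite ltr0n.
have half (A : {set 'I_n}) p : (#|A| + p <= n)%N -> (n <= p.+1.*2)%N ->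
    \sum_(s : 'S_n) expR (2%:R * (\sum_(k in A) G k (s k)
        - (\sum_(k in A) \sum_l (expR (2%:R * G k l) - 1)) / n%:R)) <= n`!%:R.
  move=> cA hp.
  pose f k l := if k \in A then expR (2%:R * G k l) - 1 else 0.
  have f0 k l : 0 <= f k l.
    rewrite /f; case: ifP => // _; rewrite subr_ge0 -[leLHS]expR0 ler_expR.
    by rewrite mulr_ge0.
  have := perm_prod_rows cA f0 (fun k l kA => ifN _ _ kA).
  set W := \sum_k \sum_l f k l => hW.
  have eW : \sum_(k in A) \sum_l (expR (2%:R * G k l) - 1) = W.
    rewrite big_mkcond; apply: eq_bigr => k _; rewrite /f.
    by case: ifP => // _; rewrite big1_eq.
  rewrite eW.
  have W0 : 0 <= W by apply: sumr_ge0 => k _; apply: sumr_ge0.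
  have e s : expR (2%:R * (\sum_(k in A) G k (s k) - W / n%:R))
     = \prod_k (1 + f k (s k)) * expR (- (W * (2%:R / n%:R))).
    rewrite mulrBr expRD; congr (_ * expR _); last by ring.
    rewrite mulr_sumr big_mkcond expR_sum; apply: eq_bigr => k _.
    by rewrite /f; case: ifP => _; rewrite ?expR0 ?addr0 // addrCA subrr addr0.
  under eq_bigr => s _ do rewrite e.
  rewrite -mulr_suml; apply: le_trans (ler_wpM2r (expR_ge0 _) hW) _.
  rewrite -mulrA -expRD ler_piMr // -[leRHS]expR0 ler_expR subr_le0 ler_wpM2l //.
  rewrite ler_pdivlMr // mulrC ler_pdivrMr ?ltr0n // mulrC -natrM ler_nat.
  by rewrite muln2.
pose A := [set k in take n./2 (enum 'I_n)].
have cA : #|A| = n./2.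
  rewrite cardsE (card_uniqP (take_uniq _ (enum_uniq _))) size_takel //.
  by rewrite size_enum_ord; lia.
have cB : #|~: A| = (n - n./2)%N by rewrite cardsCs setCK card_ord cA.
have hA := half A (n - n./2)%N; have hB := half (~: A) n./2.
rewrite cA -card_Sn in hA; rewrite cB -card_Sn in hB.
have := expR_sum_split (hA _ _) (hB _ _); rewrite card_Sn.
set a := (\sum_(k in A) _) / _; set b := (\sum_(k in ~: A) _) / _ => /(_ _ _ _ _) h.
have -> : (\sum_k \sum_l (expR (2%:R * G k l) - 1)) / n%:R = a + b.
  rewrite /a /b -mulrDl (bigID [in A]) /=; congr ((_ + _) / _).
  by apply: eq_bigl => k; rewrite in_setC.
rewrite -ler_pdivrMr ?expR_gt0 // -expRN mulr_suml.
apply: le_trans (h _ _ _ _); [|lia..].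
apply: ler_sum => s _; rewrite -expRD ler_expR (bigID [in A]) /=.
have -> : \sum_(k in ~: A) G k (s k) = \sum_(k | k \notin A) G k (s k).
  by apply: eq_bigl => k; rewrite in_setC.
lra.
Qed.

(* Values of [g] above [1 / 24] are controlled without cancellation, on each half of the rows. *)
Lemma perm_mgf n (g : 'I_n -> 'I_n -> R) :
  \sum_(s : 'S_n) expR (\sum_k g k (s k) - (\sum_k \sum_l g k l) / n%:R)
    <= n`!%:R * expR (312%:R * (\sum_k \sum_l g k l ^+ 2 * expR (4%:R * `|g k l|)) / n%:R).
Proof.
pose g1 k l := if `|g k l| <= 1 / 24%:R then g k l else 0.
pose g2 k l := if `|g k l| <= 1 / 24%:R then 0 else `|g k l|.
have small k l : `|2%:R * g1 k l| <= 1 / 12%:R.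
  rewrite /g1; case: ifP => [h|_]; last by rewrite mulr0 normr0; lra.
  by rewrite normrM ger0_norm //; lra.
have g20 k l : 0 <= g2 k l by rewrite /g2; case: ifP.
have h1 := perm_mgf_small small.
have h2 := @perm_mgf_large n (fun k l => 2%:R * g2 k l) (fun k l => mulr_ge0 (ler0n _ 2) (g20 k l)).
set a1 := (_ / _) in h1; set a2 := (_ / _) in h2.
have {}h1 : \sum_(s : 'S_n) expR (2%:R * (\sum_k g1 k (s k) - a1 / 2%:R)) <= #|'S_n|%:R.
  rewrite card_Sn -[leRHS]mulr1 -[X in _ <= _ * X](expRxMexpNx_1 a1) mulrA -ler_pdivrMr ?expR_gt0 //.
  rewrite -expRN opprK; apply: le_trans h1; rewrite mulr_suml.
  apply: ler_sum => s _; rewrite -expRD ler_expR -mulr_sumr; lra.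
have {}h2 : \sum_(s : 'S_n) expR (2%:R * (\sum_k g2 k (s k) - a2 / 2%:R)) <= #|'S_n|%:R.
  rewrite card_Sn -[leRHS]mulr1 -[X in _ <= _ * X](expRxMexpNx_1 a2) mulrA -ler_pdivrMr ?expR_gt0 //.
  rewrite -expRN opprK; apply: le_trans h2; rewrite mulr_suml.
  apply: ler_sum => s _; rewrite -expRD ler_expR -mulr_sumr; lra.
have := expR_sum_split h1 h2; rewrite card_Sn => h.
rewrite -ler_pdivrMr ?expR_gt0 // -expRN mulr_suml; apply: le_trans h.
apply: ler_sum => s _; rewrite -expRD ler_expR.
have hs : \sum_k g k (s k) <= \sum_k g1 k (s k) + \sum_k g2 k (s k).
  rewrite -big_split; apply: ler_sum => k _ /=; rewrite /g1 /g2.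
  by case: ifP => _; rewrite ?addr0 // add0r ler_norm.
suff : (a1 + a2) / 2%:R - (\sum_k \sum_l g k l) / n%:R
   <= 312%:R * (\sum_k \sum_l g k l ^+ 2 * expR (4%:R * `|g k l|)) / n%:R by lra.
rewrite /a1 /a2 -mulrDl [_ / n%:R / _]mulrAC -mulrBl ler_wpM2r ?invr_ge0 //.
rewrite mulrDl !mulr_suml -big_split -sumrB mulr_sumr; apply: ler_sum => k _ /=.
rewrite !mulr_suml -big_split -sumrB mulr_sumr; apply: ler_sum => l _ /=.
have -> : 2%:R * (2%:R * g2 k l) = 4%:R * g2 k l by ring.
rewrite /g1 /g2; case: ifP => h12.
  rewrite mulr0 expR0.
  have : 1 <= expR (4%:R * `|g k l|) by rewrite -[leLHS]expR0 ler_expR mulr_ge0.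
  have := sqr_ge0 (g k l); set X := expR _ => ? ?.
  have : g k l ^+ 2 <= g k l ^+ 2 * X by rewrite ler_peMr.
  by rewrite exprMn; lra.
(* The constant is [312 = 288 + 24]: for [y > 1 / 24], the exponential part satisfies
   [X / 2 <= 288 y^2 X], and the lost linear term satisfies [y <= 24 y^2 X]. *)
have {}h12 : 1 / 24%:R < `|g k l| by rewrite ltNge h12.
rewrite mulr0 expr0n /= mulr0.
have hX : 1 <= expR (4%:R * `|g k l|) by rewrite -[leLHS]expR0 ler_expR mulr_ge0.
rewrite -(real_normK (num_real (g k l))).
have := ler_norm (- g k l); rewrite normrN.
set X := expR _ in hX *; set y := `|_| in h12 *; move: (g k l) => G hG.
have y2 : y <= 24%:R * y ^+ 2 by nra.
have y3 : 1 / 576%:R <= y ^+ 2 by nra.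
have : y ^+ 2 <= y ^+ 2 * X by rewrite ler_peMr // sqr_ge0.
have : 1 / 576%:R * X <= y ^+ 2 * X by rewrite ler_wpM2r //; lra.
by lra.
Qed.

End PermutationMgf.

(** * Random lifts *)

Section LiftMgf.
Variable R : realType.
Variables (h n : nat) (H : rel 'I_h).
Hypotheses (Hsym : symmetric H) (Hirr : irreflexive H).
Local Open Scope ring_scope.
Local Notation V := ('I_h * 'I_n)%type.
Implicit Types s : lift_space h n.

Lemma lift_adjC s u v : lift_adj H s u v = lift_adj H s v u.
Proof.
rewrite /lift_adj Hsym; case: (ltngtP u.1 v.1) => //= e.
by rewrite (val_inj e) Hirr.
Qed.

Definition base_mean (u v : V) : R := (H u.1 v.1)%:R / n%:R.
Definition centered_adj s (u v : V) : R := (lift_adj H s u v)%:R - base_mean u v.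
Definition deviation (c : V -> V -> R) s : R := \sum_u \sum_v c u v * centered_adj s u v.
(** Bound for the logarithm of the moment generating function of [deviation c]. An unordered pair
    occurs twice in [deviation], so [perm_mgf] is applied to [2 c]; hence the 8 in the exponent and
    [624 = 2 * 312]. *)
Definition mgf_cost (c : V -> V -> R) : R :=
  624%:R * (\sum_u \sum_v (H u.1 v.1)%:R * (c u v ^+ 2 * expR (8%:R * `|c u v|))) / n%:R.

Lemma centered_adjC s u v : centered_adj s u v = centered_adj s v u.
Proof. by rewrite /centered_adj /base_mean lift_adjC Hsym. Qed.

Lemma sum_fibres (G : V -> R) : \sum_u G u = \sum_i \sum_k G (i, k).
Proof. by rewrite pair_bigA; apply: eq_bigr => -[]. Qed.

Lemma sum_blocks (G : V -> V -> R) :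
  \sum_u \sum_v G u v = \sum_i \sum_j \sum_k \sum_l G (i, k) (j, l).
Proof.
rewrite sum_fibres; apply: eq_bigr => i _.
by under eq_bigr => k _ do rewrite sum_fibres; rewrite exchange_big.
Qed.

Lemma sum_sym_lt (F : 'I_h -> 'I_h -> R) :
  (forall i j, F i j = F j i) -> (forall i, F i i = 0) ->
  \sum_i \sum_j F i j = \sum_(p : 'I_h * 'I_h) if (p.1 < p.2)%N then 2%:R * F p.1 p.2 else 0.
Proof.
move=> Fsym F0.
rewrite -(pair_bigA _ (fun i j : 'I_h => if (i < j)%N then 2%:R * F i j else 0)) /=.
have -> : \sum_i \sum_j F i j
   = \sum_(i < h) \sum_(j < h) ((if (i < j)%N then F i j else 0) + (if (j < i)%N then F i j else 0)).
  apply: eq_bigr => i _; apply: eq_bigr => j _.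
  by case: ltngtP => [||e]; rewrite ?addr0 ?add0r // (val_inj e) F0.
under [LHS]eq_bigr => i _ do rewrite big_split /=.
rewrite big_split /= [X in _ + X]exchange_big -big_split; apply: eq_bigr => i _ /=.
rewrite -big_split; apply: eq_bigr => j _ /=.
by case: ifP => _; rewrite ?addr0 // (Fsym j); ring.
Qed.

(** Symmetric sums are folded onto the pairs with [p.1 < p.2] because those are the coordinates of
    [s] from which the lift is built. *)
Lemma sum_blocks_lt (G : V -> V -> R) :
  (forall u v, G u v = G v u) -> (forall u v, u.1 = v.1 -> G u v = 0) ->
  \sum_u \sum_v G u v
    = \sum_(p : 'I_h * 'I_h) if (p.1 < p.2)%N then \sum_k \sum_l 2%:R * G (p.1, k) (p.2, l) else 0.
Proof.
move=> Gsym G0; rewrite sum_blocks sum_sym_lt => [|i j|i].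
- apply: eq_bigr => p _; case: ifP => // _.
  by rewrite mulr_sumr; apply: eq_bigr => k _; rewrite mulr_sumr.
- rewrite exchange_big; apply: eq_bigr => k _; apply: eq_bigr => l _.
  exact: Gsym.
by rewrite big1 // => k _; rewrite big1 // => l _; apply: G0.
Qed.

(** The deviation is a sum over base pairs [p] of functions of the single permutation [s p]. These
    are independent, so the sum over [s] factors into a product over [p], and [perm_mgf] bounds each
    factor. *)
Lemma deviation_mgf (c : V -> V -> R) : (forall u v, c u v = c v u) ->
  \sum_s expR (deviation c s) <= #|lift_space h n|%:R * expR (mgf_cost c).
Proof.
move=> csym.
pose g (p : 'I_h * 'I_h) k l : R :=
  if (p.1 < p.2)%N && H p.1 p.2 then 2%:R * c (p.1, k) (p.2, l) else 0.
have Hd (u v : V) : u.1 = v.1 -> H u.1 v.1 = false by move=> ->; rewrite Hirr.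
have eM s : \sum_u \sum_v c u v * (lift_adj H s u v)%:R = \sum_p \sum_k g p k (s p k).
  rewrite sum_blocks_lt => [|u v|u v uv].
  - apply: eq_bigr => -[i j] _ /=; rewrite /g /=.
    case: ifP => ij /=; last by rewrite big1_eq.
    apply: eq_bigr => k _; rewrite (bigD1 (s (i, j) k)) //= big1 => [|l ls].
      by rewrite /lift_adj /= ij eqxx andbT addr0; case: ifP; rewrite ?mulr1 ?mulr0.
    by rewrite /lift_adj /= ij eq_sym (negPf ls) andbF !mulr0.
  - by rewrite csym lift_adjC.
  - by rewrite /lift_adj Hd // mulr0.
have em : \sum_u \sum_v c u v * base_mean u v = \sum_p (\sum_k \sum_l g p k l) / n%:R.
  rewrite sum_blocks_lt => [|u v|u v uv].
  - apply: eq_bigr => -[i j] _ /=; rewrite /g /=.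
    case: ifP => ij /=; last by rewrite big1 ?mul0r // => k _; rewrite big1_eq.
    rewrite mulr_suml; apply: eq_bigr => k _; rewrite mulr_suml; apply: eq_bigr => l _.
    by rewrite /base_mean /=; case: ifP => _; rewrite ?mul0r ?mulr0 // mul1r mulrA.
  - by rewrite csym /base_mean Hsym.
  - by rewrite /base_mean Hd // mul0r mulr0.
have eC : mgf_cost c = \sum_p (312%:R * (\sum_k \sum_l g p k l ^+ 2 * expR (4%:R * `|g p k l|)) / n%:R).
  rewrite /mgf_cost sum_blocks_lt => [|u v|u v uv].
  - rewrite mulr_sumr mulr_suml; apply: eq_bigr => -[i j] _ /=; rewrite /g /=.
    congr (_ / _); case: ifP => ij /=; last first.
      by rewrite mulr0 big1 ?mulr0 // => k _; rewrite big1 // => l _; rewrite expr0n mul0r.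
    rewrite !mulr_sumr; apply: eq_bigr => k _; rewrite !mulr_sumr; apply: eq_bigr => l _.
    case: ifP => _; last by rewrite expr0n !mul0r !mulr0.
    rewrite normrM ger0_norm // (_ : 4%:R * (2%:R * _) = 8%:R * `|c (i, k) (j, l)|); last by ring.
    by rewrite exprMn /= mulr1n; ring.
  - by rewrite csym Hsym.
  - by rewrite Hd // mul0r.
have edev s : deviation c s
    = \sum_p (\sum_k g p k (s p k) - (\sum_k \sum_l g p k l) / n%:R).
  rewrite sumrB -eM -em -sumrB; apply: eq_bigr => u _.
  by rewrite -sumrB; apply: eq_bigr => v _; rewrite -mulrBr.
under eq_bigr => s _ do rewrite edev expR_sum.
rewrite -(bigA_distr_bigA (fun p (t : 'S_n) =>
   expR (\sum_k g p k (t k) - (\sum_k \sum_l g p k l) / n%:R))) /=.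
have -> : #|lift_space h n|%:R = \prod_(p : 'I_h * 'I_h) n`!%:R :> R.
  by rewrite card_ffun card_Sn natrX prodr_const.
rewrite eC expR_sum -big_split; apply: ler_prod => p _ /=.
rewrite perm_mgf andbT; apply: sumr_ge0 => t _; exact: expR_ge0.
Qed.

End LiftMgf.

(** * Union bounds *)

Section UnionBound.
Variable R : realType.
Local Open Scope ring_scope.

(** Union bound with Kraft weights: Markov's inequality makes event [p] have probability at most
    [expR (- l p - eta)], and the weights [expR (- l p)] sum to at most 1. *)
Lemma card_exists_exp (T P : finType) (A : pred P) (l : P -> R) (Z : P -> T -> R) (eta : R) :
  \sum_(p | A p) expR (- l p) <= 1 -> (forall p, \sum_t expR (Z p t) <= #|T|%:R) ->
  #|[set t | [exists p, A p && (l p + eta < Z p t)]]|%:R <= #|T|%:R * expR (- eta).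
Proof.
move=> hl hZ.
rewrite -sum1_card natr_sum big_mkcond /=.
have h t : (if t \in [set t | [exists p, A p && (l p + eta < Z p t)]] then 1%:R else 0)
   <= \sum_(p | A p) expR (- l p) * (expR (Z p t) * expR (- eta)).
  rewrite inE; case: ifP => [/existsP[p /andP[Ap hp]]|_]; last first.
    by apply: sumr_ge0 => p _; rewrite !mulr_ge0 ?expR_ge0.
  rewrite (bigD1 p) //= -!expRD -[leLHS]addr0 lerD //.
    by rewrite mulr1n -[leLHS]expR0 ler_expR; lra.
  by apply: sumr_ge0 => q _; rewrite !mulr_ge0 ?expR_ge0.
apply: le_trans (ler_sum _ (fun t _ => h t)) _.
rewrite exchange_big /=.
have h2 p : \sum_t expR (- l p) * (expR (Z p t) * expR (- eta))
   <= expR (- l p) * (#|T|%:R * expR (- eta)).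
  by rewrite -mulr_sumr -mulr_suml ler_wpM2l ?expR_ge0 // ler_wpM2r ?expR_ge0.
apply: le_trans (ler_sum _ (fun p _ => h2 p)) _.
by rewrite -mulr_suml ler_piMl // mulr_ge0 ?expR_ge0.
Qed.

Lemma geometric_tail (x : R) (kappa m : nat) : 0 <= x < 1 ->
  \sum_(k < m | (kappa <= k)%N) x ^+ k <= x ^+ kappa / (1 - x).
Proof.
move=> /andP[x0 x1]; have x1' : 0 < 1 - x by rewrite subr_gt0.
rewrite ler_pdivlMr //.
suff : (\sum_(k < m | (kappa <= k)%N) x ^+ k) * (1 - x) + x ^+ maxn kappa m <= x ^+ kappa.
  by have := exprn_ge0 (maxn kappa m) x0; lra.
elim: m => [|m IH]; first by rewrite big_ord0 mul0r add0r maxn0.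
rewrite big_mkcond big_ord_recr -big_mkcond /=; case: ifP => km.
  rewrite (maxn_idPr _) in IH; last by [].
  rewrite (maxn_idPr _); last by rewrite ltnW.
  by rewrite mulrDl exprSr; lra.
rewrite addr0; move: IH; rewrite !(maxn_idPl _) //; lia.
Qed.

End UnionBound.

(** * Groups of pairs of vertices *)

Section GroupEvents.
Variable R : realType.
Variables (h n : nat) (H : rel 'I_h).
Hypotheses (Hsym : symmetric H) (Hirr : irreflexive H).
Local Open Scope ring_scope.
Local Notation V := ('I_h * 'I_n)%type.
Variables (D : nat) (d : 'I_h -> nat).
Implicit Types (k : V -> nat) (sg tau : V -> R) (a r : nat) (u v : V).

Definition level k u := (d u.1 + k u)%N.
(* [rank k a u] is the least [r] with [k u <= 2 ^ (r + (level k u - a))], for [a <= level k u]. *)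
Definition rank k a u := (up_log 2 (k u) - (level k u - a))%N.
Definition active k a r u := (a <= level k u)%N && (rank k a u <= r)%N.
Definition near_levels k u v :=
  (level k u <= level k v + D)%N && (level k v <= level k u + D)%N.
Definition pair_in_group k a r u v :=
  [&& near_levels k u v, a == minn (level k u) (level k v)
    & r == maxn (rank k a u) (rank k a v)].
(** The product of the two sign vectors is symmetrised because [deviation_mgf] needs symmetric
    coefficients; against a symmetric matrix this leaves the bilinear form unchanged. *)
Definition pair_weight k sg tau u v : R :=
  2%:R ^+ level k u * 2%:R ^+ level k v * ((sg u * tau v + sg v * tau u) / 2%:R).
(** The Chernoff parameter of a group. For [a = level k u <= level k v] it makes
    [8 * tilt * 2 ^ level k u * 2 ^ level k v] equal to [2 ^ r * 2 ^ (level k v - level k u) / (8 *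
    2 ^ D)]. *)
Definition tilt a r : R := 2%:R ^+ r / (64%:R * 4%:R ^+ a * 2%:R ^+ D).
Definition group_coef k sg tau a r u v : R :=
  tilt a r * pair_weight k sg tau u v * (pair_in_group k a r u v)%:R.
(* A Kraft code for the heights and signs of the vertices of a group: [4 (k u + 1)] for an active
   vertex, and a cost for the others which decreases geometrically with [a - d i], since few
   vertices of the fibre [i] have height at least [a - d i]. *)
Definition code_length k a r : R :=
  \sum_u (if active k a r u then 4%:R * (k u).+1%:R else (16%:R ^+ (a - d u.1))^-1).

Lemma near_levelsC k u v : near_levels k u v = near_levels k v u.
Proof. by rewrite /near_levels andbC. Qed.

Lemma pair_in_groupC k a r u v : pair_in_group k a r u v = pair_in_group k a r v u.
Proof. by rewrite /pair_in_group near_levelsC minnC maxnC. Qed.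

Lemma pair_weightC k sg tau u v : pair_weight k sg tau u v = pair_weight k sg tau v u.
Proof. by rewrite /pair_weight; ring. Qed.

Lemma group_coefC k sg tau a r u v :
  group_coef k sg tau a r u v = group_coef k sg tau a r v u.
Proof. by rewrite /group_coef pair_weightC pair_in_groupC. Qed.

Lemma pair_in_group_active k a r u v : pair_in_group k a r u v -> active k a r u && active k a r v.
Proof.
case/and3P => _ /eqP-> /eqP->; rewrite /active geq_minl geq_minr.
by rewrite leq_maxl leq_maxr.
Qed.

Section Labels.
Variable m : nat.
(* [inl tt] labels the inactive vertices; an active one carries its height and two signs. *)
Let label := (unit + 'I_m * (bool * bool))%type.

Let lab_height (l : label) : nat := if l is inr p then p.1 else 0.
Let lab_sign1 (l : label) : R := if l is inr p then (-1) ^+ p.2.1 else 0.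
Let lab_sign2 (l : label) : R := if l is inr p then (-1) ^+ p.2.2 else 0.
Let lab_allowed a (i : 'I_h) (l : label) := if l is inr p then (a <= d i + p.1)%N else true.
Let lab_length a (i : 'I_h) (l : label) : R :=
  if l is inr p then 4%:R * p.1.+1%:R else (16%:R ^+ (a - d i))^-1.

(** Put [x = 16 ^ -(a - d i)]. An allowed active label has height at least [a - d i], and four sign
    choices, so the active labels weigh at most [4/15 x]. The inactive one weighs
    [expR (- x) <= 1 / (1 + x) <= 1 - 4/15 x]. *)
Let kraft1 a i : \sum_(l | lab_allowed a i l) expR (- lab_length a i l) <= 1.
Proof.
rewrite big_sumType /= big_const card_unit /= addr0.
set x := (_)^-1.
have x0 : 0 < x by rewrite invr_gt0 exprn_gt0.
have x1 : x <= 1 by rewrite invf_le1 ?exprn_gt0 // exprn_ege1 // ler1n.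
have e4 : expR (- 4%:R) <= 16%:R^-1 :> R.
  rewrite expRN lef_pV2 ?posrE ?expR_gt0 //.
  have h2 := expR_ge1Dx (1 : R).
  rewrite -[4%:R in leRHS]mulr1 expRM_natl.
  rewrite (_ : 16%:R = 2%:R ^+ 4); last by ring.
  by rewrite lerXn2r ?nnegrE ?expR_ge0.
have hk : \sum_(p : 'I_m * (bool * bool) | (a <= d i + p.1)%N) expR (- (4%:R * p.1.+1%:R))
   <= 4%:R / 15%:R * x.
  rewrite big_mkcond /= -(pair_bigA _ (fun (p1 : 'I_m) (p2 : bool * bool) =>
     if (a <= d i + p1)%N then expR (- (4%:R * p1.+1%:R)) else 0)) /=.
  have e1 (p1 : 'I_m) : \sum_(p2 : bool * bool)
      (if (a <= d i + p1)%N then expR (- (4%:R * p1.+1%:R)) else 0 : R)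
     <= 4%:R / 16%:R * (if (a - d i <= p1)%N then 16%:R^-1 ^+ p1 else 0).
    rewrite sumr_const card_prod card_bool leq_subLR; case: ifP => _; last by rewrite mul0rn mulr0.
    rewrite -mulNr mulrC expRM_natl.
    have : expR (- 4%:R) ^+ p1.+1 <= 16%:R^-1 ^+ p1.+1 :> R.
      by rewrite lerXn2r ?nnegrE ?expR_ge0 ?invr_ge0.
    rewrite [in leRHS]exprS; set y := _ ^+ p1.+1; set w := _ ^+ p1 => ?.
    by rewrite -mulr_natl; lra.
  apply: le_trans (ler_sum _ (fun p _ => e1 p)) _.
  rewrite -mulr_sumr -big_mkcond /=.
  have x16 : 0 <= (16%:R^-1 : R) < 1 by lra.
  have := geometric_tail (R := R) (a - d i) m x16.
  rewrite exprVn -/x (_ : x / (1 - _) = 16%:R / 15%:R * x); last by field.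
  by set S := \sum_(_ < _ | _) _ => ?; lra.
have hx : expR (- x) * (1 + x) <= 1.
  rewrite -[leRHS](expRxMexpNx_1 x) mulrC ler_wpM2r ?expR_ge0 //.
  exact: expR_ge1Dx.
have : 1 <= (1 - 4%:R / 15%:R * x) * (1 + x) by nra.
move=> h1; have : expR (- x) <= 1 - 4%:R / 15%:R * x.
  by rewrite -(ler_pM2r (x := 1 + x)) ?(le_trans hx) //; lra.
by lra.
Qed.

Let kraft a : \sum_(phi : {ffun V -> label} | phi \in family (fun u => lab_allowed a u.1))
   expR (- \sum_u lab_length a u.1 (phi u)) <= 1.
Proof.
under eq_bigr => phi _ do rewrite -sumrN expR_sum.
rewrite -(bigA_distr_big_dep (fun u : V => lab_allowed a u.1)
   (fun (u : V) l => expR (- lab_length a u.1 l))) /=.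
apply: le_trans (_ : _ <= \prod_(u : V) 1) _; last by rewrite big1_eq.
apply: ler_prod => u _; rewrite kraft1 andbT.
by apply: sumr_ge0 => l _; apply: expR_ge0.
Qed.

(** The coefficients of a group depend only on the data of its active vertices. The union bound thus
    runs over labellings that forget the other vertices, with code length [code_length]. *)
Lemma card_group_event a r (eta : R) :
  #|[set s : lift_space h n | [exists k : {ffun V -> 'I_m}, exists sg : {ffun V -> bool},
      exists tau : {ffun V -> bool},
      let kn := fun u => k u : nat in let c := group_coef kn (fun u => (-1) ^+ sg u) (fun u => (-1) ^+ tau u) a r in
      code_length kn a r + mgf_cost H c + eta < deviation H c s]]|%:R
  <= #|lift_space h n|%:R * expR (- eta).
Proof.
pose coef (phi : {ffun V -> label}) := group_coef (fun u => lab_height (phi u))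
  (fun u => lab_sign1 (phi u)) (fun u => lab_sign2 (phi u)) a r.
pose Z phi (s : lift_space h n) : R := deviation H (coef phi) s - mgf_cost H (coef phi).
have hZ phi : \sum_s expR (Z phi s) <= #|lift_space h n|%:R.
  under eq_bigr => s _ do rewrite /Z expRD.
  rewrite -mulr_suml.
  have := deviation_mgf Hsym Hirr (fun u v => group_coefC _ _ _ _ _ u v) (c := coef phi).
  move/(ler_wpM2r (expR_ge0 (- mgf_cost H (coef phi)))) => hh; apply: le_trans hh _.
  by rewrite -mulrA expRxMexpNx_1 mulr1.
apply: le_trans (card_exists_exp eta (kraft a) hZ).
rewrite ler_nat; apply/subset_leq_card/subsetP => s; rewrite !inE.
case/existsP => k /existsP[sg /existsP[tau /= hs]].
pose kn u : nat := k u.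
pose phi : {ffun V -> label} :=
  [ffun u => if active kn a r u then inr (k u, (sg u, tau u)) else inl tt].
apply/existsP; exists phi; apply/andP; split.
  apply/familyP => u; rewrite /phi ffunE unfold_in.
  by case: ifP => // /andP[].
(* A pair with an inactive end is outside the group on the right, and has weight 0 on the left since
   [inl tt] carries sign 0. Pairs of active vertices have the same data on both sides. *)
have ec : coef phi = group_coef kn (fun u => (-1) ^+ sg u) (fun u => (-1) ^+ tau u) a r.
  apply/funext => u; apply/funext => v; rewrite /coef /group_coef.
  have [hg|hg] := boolP (pair_in_group kn a r u v); last first.
    rewrite mulr0; have [|] := boolP (active kn a r u && active kn a r v); last first.
      rewrite negb_and => /orP[] /negPf hact;
      rewrite /pair_weight !ffunE hact /= ?mul0r ?mulr0 ?addr0 ?mul0r ?mulr0 ?mul0r //.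
    case/andP=> au av.
    suff -> : pair_in_group (fun u => lab_height (phi u)) a r u v = pair_in_group kn a r u v.
      by rewrite (negPf hg) mulr0.
    by rewrite /pair_in_group /near_levels /rank /level !ffunE au av.
  have /andP[au av] := pair_in_group_active hg.
  have -> : pair_in_group (fun u => lab_height (phi u)) a r u v = pair_in_group kn a r u v.
    by rewrite /pair_in_group /near_levels /rank /level !ffunE au av.
  by rewrite hg /pair_weight /level !ffunE au av.
rewrite /Z ec ltrBrDr; apply: le_lt_trans hs; rewrite addrAC lerD2r lerD2r.
apply: ler_sum => u _; rewrite /phi ffunE.
by case: ifP.
Qed.

End Labels.
End GroupEvents.

(** * Levels of a vector *)

Section Levels.
Variable R : realType.
Variables (h n : nat).
Local Open Scope ring_scope.
Local Notation V := ('I_h * 'I_n)%type.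

(** Both [d i] and [k u] are chosen minimal, so the defining bounds are tight up to a factor 4 when
    the exponent is positive; this gives [5 = 1 + 4] and [9 = 5 + 4]. The bound [d i <= h] leaves a
    number of choices of [d] independent of [n]. *)
Lemma exists_levels (x : V -> R) : \sum_u x u ^+ 2 = (h * n)%:R ->
  exists (d : 'I_h -> nat) (k : V -> nat),
  [/\ [/\ forall i, (d i <= h)%N, forall u, (k u <= n)%N,
        forall u, `|x u| <= 2%:R ^+ level d k u &
        forall u, (0 < k u)%N -> 4%:R ^+ level d k u <= 4%:R * x u ^+ 2],
      forall i, \sum_l 4%:R ^+ k (i, l) <= 5%:R * n%:R :> R,
      \sum_u 4%:R ^+ level d k u <= 9%:R * (h * n)%:R :> R &
      \sum_(i < h) n%:R * 4%:R ^+ d i <= 5%:R * (h * n)%:R :> R].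
Proof.
move=> sx.
pose m i := \sum_l x (i, l) ^+ 2.
have m0 i : 0 <= m i by apply: sumr_ge0 => l _; apply: sqr_ge0.
have sm : \sum_i m i = (h * n)%:R by rewrite -(sum_fibres (fun u => x u ^+ 2)).
have mle i : m i <= (h * n)%:R by rewrite -sm (bigD1 i) //= lerDl sumr_ge0.
have exd i : exists e, m i <= n%:R * 4%:R ^+ e.
  exists h; apply: le_trans (mle i) _.
  rewrite -natrX -natrM ler_nat mulnC leq_mul2l; apply/orP; right.
  by apply/ltnW/ltn_expl.
pose d i := ex_minn (exd i).
have dP i : m i <= n%:R * 4%:R ^+ d i by rewrite /d; case: ex_minnP.
have dh i : (d i <= h)%N.
  rewrite /d; case: ex_minnP => e _; apply; apply: le_trans (mle i) _.
  rewrite -natrX -natrM ler_nat mulnC leq_mul2l; apply/orP; right.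
  by apply/ltnW/ltn_expl.
have dm i : n%:R * 4%:R ^+ d i <= n%:R + 4%:R * m i.
  rewrite /d; case: ex_minnP => -[|e] _ hmin.
    by rewrite expr0 mulr1 lerDl mulr_ge0.
  have : ~~ (m i <= n%:R * 4%:R ^+ e) by apply/negP => /hmin; rewrite ltnn.
  rewrite -ltNge exprS => hlt; have : 0 <= n%:R :> R by [].
  by lra.
have n4 : n%:R <= 4%:R ^+ n :> R by rewrite -natrX ler_nat; apply/ltnW/ltn_expl.
have exk u : `|x u| <= 2%:R ^+ (d u.1 + n).
  rewrite -(@ler_pXn2r _ 2) ?nnegrE ?exprn_ge0 // real_normK ?num_real //.
  rewrite -exprM mulnC exprM (_ : 2%:R ^+ 2 = 4%:R); last by ring.
  apply: le_trans (_ : m u.1 <= _).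
    by case: u => i l; rewrite /m (bigD1 l) //= lerDl sumr_ge0 // => *; apply: sqr_ge0.
  apply: le_trans (dP _) _; rewrite exprD mulrC ler_wpM2l ?exprn_ge0 //.
pose k u := ex_minn (ex_intro (fun e => `|x u| <= 2%:R ^+ (d u.1 + e)) n (exk u)).
have kP u : `|x u| <= 2%:R ^+ level d k u by rewrite /level /k; case: ex_minnP.
have kn u : (k u <= n)%N by rewrite /k; case: ex_minnP => e _; apply.
have kpos u : (0 < k u)%N -> 4%:R ^+ level d k u <= 4%:R * x u ^+ 2.
  rewrite /level /k; case: ex_minnP => -[|e] _ hmin // _.
  have : ~~ (`|x u| <= 2%:R ^+ (d u.1 + e)) by apply/negP => /hmin; rewrite ltnn.
  rewrite -ltNge => /ltW hlt.
  have : (2%:R ^+ (d u.1 + e)) ^+ 2 <= `|x u| ^+ 2.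
    by rewrite lerXn2r ?nnegrE ?exprn_ge0.
  rewrite real_normK ?num_real // -exprM mulnC exprM (_ : 2%:R ^+ 2 = 4%:R); last by ring.
  by rewrite addnS (exprS 4%:R) => ?; rewrite ler_wpM2l.
have lvl u : 4%:R ^+ level d k u <= 4%:R ^+ d u.1 + 4%:R * x u ^+ 2.
  have [k0|kp] := posnP (k u).
    by rewrite {1}/level k0 addn0 lerDl mulr_ge0 ?sqr_ge0.
  by apply: le_trans (kpos u kp) _; rewrite lerDr exprn_ge0.
have sd : \sum_(i < h) n%:R * 4%:R ^+ d i <= 5%:R * (h * n)%:R :> R.
  apply: le_trans (ler_sum _ (fun i _ => dm i)) _.
  rewrite big_split /= -mulr_sumr sm sumr_const card_ord -mulr_natl -natrM.
  by lra.
exists d, k; split => // [i|].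
  have p4 : 0 < 4%:R ^+ d i :> R by rewrite exprn_gt0.
  rewrite -(ler_pM2l p4) mulr_sumr.
  have hl l : 4%:R ^+ d i * 4%:R ^+ k (i, l) <= 4%:R ^+ d i + 4%:R * x (i, l) ^+ 2.
    by rewrite -exprD; apply: lvl.
  apply: le_trans (ler_sum _ (fun l _ => hl l)) _.
  rewrite big_split /= -mulr_sumr sumr_const card_ord -[_ ^+ _ *+ n]mulr_natl -/(m i).
  by have := dP i; lra.
apply: le_trans (ler_sum _ (fun u _ => lvl u)) _.
rewrite big_split /= -mulr_sumr sx (sum_fibres (fun u => 4%:R ^+ d u.1)).
have -> : \sum_i \sum_(l < n) 4%:R ^+ d (i, l).1 = \sum_(i < h) n%:R * 4%:R ^+ d i :> R.
  by apply: eq_bigr => i _; rewrite /= sumr_const card_ord mulr_natl.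
by lra.
Qed.

(** The bilinear form is linear in each factor, so over the box given by [w] it is maximal at sign
    vectors. The first factor is replaced, then the second; symmetry of [C] allows averaging the two
    orders. *)
Lemma exists_signs (C : V -> V -> R) (x w : V -> R) :
  (forall u v, C u v = C v u) -> (forall u, `|x u| <= w u) ->
  exists sg tau : {ffun V -> bool},
    `|\sum_u \sum_v C u v * (x u * x v)|
     <= \sum_u \sum_v C u v * (w u * w v * (((-1) ^+ sg u * (-1) ^+ tau v
                                          + (-1) ^+ sg v * (-1) ^+ tau u) / 2%:R)).
Proof.
move=> Csym hx.
pose c u := \sum_v C u v * x v.
pose sg := [ffun u => c u < 0].
pose y u : R := w u * (-1) ^+ sg u.
pose e v := \sum_u C u v * y u.
pose tau := [ffun v => e v < 0].
pose z v : R := w v * (-1) ^+ tau v.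
exists sg, tau.
have w0 u : 0 <= w u by apply: le_trans (hx u).
have absE (t : R) : `|t| = (-1) ^+ (t < 0)%R * t.
  case: ltrP => t0; first by rewrite ltr0_norm // mulN1r.
  by rewrite ger0_norm // mul1r.
have e1 : \sum_u \sum_v C u v * (x u * x v) = \sum_u x u * c u.
  by apply: eq_bigr => u _; rewrite mulr_sumr; apply: eq_bigr => v _; ring.
have e2 : \sum_u y u * c u = \sum_v x v * e v.
  rewrite /c; under eq_bigr => u _ do rewrite mulr_sumr.
  rewrite exchange_big; apply: eq_bigr => v _; rewrite mulr_sumr.
  by apply: eq_bigr => u _; ring.
have e3 : \sum_v z v * e v = \sum_u \sum_v C u v * (w u * w v * (((-1) ^+ sg u * (-1) ^+ tau v
                                          + (-1) ^+ sg v * (-1) ^+ tau u) / 2%:R)).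
  have a1 : \sum_v z v * e v = \sum_u \sum_v C u v * (y u * z v).
    rewrite exchange_big; apply: eq_bigr => v _; rewrite mulr_sumr.
    by apply: eq_bigr => u _; ring.
  have a2 : \sum_v z v * e v = \sum_u \sum_v C u v * (y v * z u).
    rewrite a1 exchange_big; apply: eq_bigr => u _; apply: eq_bigr => v _.
    by rewrite Csym.
  have -> : \sum_v z v * e v = (\sum_v z v * e v + \sum_v z v * e v) / 2%:R by field.
  rewrite {1}a1 a2 -big_split mulr_suml; apply: eq_bigr => u _ /=.
  rewrite -big_split mulr_suml; apply: eq_bigr => v _ /=.
  by rewrite /y /z; ring.
rewrite -e3 e1.
have s1 : `|\sum_u x u * c u| <= \sum_u y u * c u.
  apply: le_trans (ler_norm_sum _ _ _) _; apply: ler_sum => u _.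
  by rewrite normrM (absE (c u)) /y ffunE -mulrA ler_wpM2r // -absE.
apply: le_trans s1 _; rewrite e2; apply: ler_sum => v _.
apply: le_trans (ler_norm _) _.
by rewrite normrM (absE (e v)) /z ffunE -mulrA ler_wpM2r // -absE.
Qed.

End Levels.

(** * Elementary numerical estimates *)

Section Numeric.
Variable R : realType.
Local Open Scope ring_scope.

Lemma geometric_upto (c : R) (l N : nat) : 1 < c ->
  \sum_(a < N | (a <= l)%N) c ^+ a <= c ^+ l.+1 / (c - 1).
Proof.
move=> c1; have c0 : 0 <= c by lra.
rewrite ler_pdivlMr ?subr_gt0 //.
suff : (\sum_(a < N | (a <= l)%N) c ^+ a) * (c - 1) <= c ^+ minn N l.+1 - 1.
  move=> h; apply: le_trans h _; rewrite lerBlDr -[leLHS]addr0 lerD //.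
  by rewrite ler_weXn2l ?geq_minr // ltW.
elim: N => [|N IH]; first by rewrite big_ord0 mul0r min0n expr0 subrr.
rewrite big_mkcond big_ord_recr -big_mkcond /=; case: ifP => Nl.
  rewrite (minn_idPl _) in IH; last by rewrite ltnW.
  by rewrite (minn_idPl _) // mulrDl exprSr; lra.
rewrite addr0; move: IH; rewrite !(minn_idPr _) //; lia.
Qed.

Lemma expR_quarter k : expR (k%:R / 4%:R) <= 2%:R ^+ k :> R.
Proof.
rewrite expRM_natl lerXn2r ?nnegrE ?expR_ge0 //.
have := @expR_le_quadratic R 4%:R^-1; rewrite ger0_norm ?invr_ge0 // mul1r lexx => /(_ isT).
by move=> h; apply: le_trans h _; lra.
Qed.

Lemma leq_sqr_pow2 k : (k ^ 2 <= 2 * 2 ^ k)%N.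
Proof.
case: k => [|[|[|k]]] //; elim: k => // k IH.
rewrite [(2 ^ _)%N]expnS; move: IH; rewrite -!mulnn; set X := (2 ^ _)%N; nia.
Qed.

Lemma leq_pow2_up_log k : (0 < k)%N -> (2 ^ up_log 2 k <= 2 * k)%N.
Proof.
case: k => [|[|k]] // _.
have := up_log_gtn (isT : 1 < 2)%N (isT : 1 < k.+2)%N.
have : (0 < up_log 2 k.+2)%N by rewrite up_log_gt0.
by case: up_log => // u _ /=; rewrite expnS; lia.
Qed.

Lemma exchange_big_pairs (I J K L : finType) (F : I -> J -> K -> L -> R) :
  \sum_i \sum_j \sum_k \sum_l F i j k l = \sum_k \sum_l \sum_i \sum_j F i j k l.
Proof.
under eq_bigr => i _ do rewrite exchange_big /=.
rewrite exchange_big /=; apply: eq_bigr => k _.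
by under eq_bigr => i _ do rewrite exchange_big /=; rewrite exchange_big.
Qed.

Lemma up_log2_le k : (up_log 2 k <= k)%N.
Proof. by apply: up_log_min => //; apply/ltnW/ltn_expl. Qed.

End Numeric.

(** * Summing the group bounds *)

Section Deterministic.
Variable R : realType.
Variables (h n : nat) (H : rel 'I_h).
Hypotheses (Hsym : symmetric H) (Hirr : irreflexive H) (npos : (0 < n)%N).
Local Open Scope ring_scope.
Local Notation V := ('I_h * 'I_n)%type.

Lemma sum_base_degree (i : 'I_h) : \sum_j (H i j)%:R <= (maxdeg H)%:R :> R.
Proof.
rewrite -natr_sum ler_nat.
have -> : (\sum_j H i j = #|[set j | H i j]|)%N.
  by rewrite -sum1_card [in RHS]big_mkcond; apply: eq_bigr => j _; rewrite inE; case: (H i j).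
by rewrite /maxdeg; apply: (leq_bigmax (F := fun i => #|[set j | H i j]|)).
Qed.

(** The fibre over a base neighbour [j] contains exactly one neighbour of [u]: the image of [u.2]
    under a permutation or its inverse, according to the order of [u.1] and [j]. *)
Lemma lift_adj_degreeE (s : lift_space h n) u :
  \sum_v (lift_adj H s u v)%:R = \sum_j (H u.1 j)%:R :> R.
Proof.
rewrite sum_fibres; apply: eq_bigr => j _; rewrite /lift_adj /=.
case: (H u.1 j) => /=; last by rewrite big1.
case: (u.1 < j)%N.
  rewrite (bigD1 (s (u.1, j) u.2)) //= eqxx big1 ?addr0 // => l ls.
  by rewrite eq_sym (negPf ls).
rewrite (bigD1 ((s (j, u.1))^-1%g u.2)) //= permKV eqxx big1 ?addr0 // => l ls.
by case: eqP => // e; rewrite -e permK eqxx in ls.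
Qed.

Lemma lift_adj_degree (s : lift_space h n) u :
  \sum_v (lift_adj H s u v)%:R <= (maxdeg H)%:R :> R.
Proof. by rewrite lift_adj_degreeE sum_base_degree. Qed.

Lemma base_mean_degree u : \sum_(v : V) base_mean R H u v <= (maxdeg H)%:R.
Proof.
rewrite sum_fibres; apply: le_trans (sum_base_degree u.1).
apply: ler_sum => j _; rewrite /base_mean /= sumr_const card_ord -[_ *+ n]mulr_natr divfK //.
by rewrite pnatr_eq0 -lt0n.
Qed.

Lemma normr_centered_adj (s : lift_space h n) u v :
  `|centered_adj R H s u v| <= (lift_adj H s u v)%:R + base_mean R H u v.
Proof.
rewrite /centered_adj; apply: le_trans (ler_normB _ _) _.
by rewrite !ger0_norm // /base_mean divr_ge0.
Qed.

Variables (D : nat) (d : 'I_h -> nat) (k : V -> nat).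
Local Notation q := (2%:R ^+ D : R).
Local Notation lvl := (level d k).
Hypothesis degq : (maxdeg H)%:R <= q ^+ 2.
Hypothesis fibre_mass : forall i, \sum_l 4%:R ^+ k (i, l) <= 5%:R * n%:R :> R.

Lemma q_gt0 : 0 < q. Proof. by rewrite exprn_gt0. Qed.

Lemma tilt_gt0 a r : 0 < tilt R D a r.
Proof. by rewrite divr_gt0 ?mulr_gt0 ?exprn_gt0. Qed.

Lemma tiltV a r : (tilt R D a r)^-1 = 64%:R * q * (4%:R ^+ a * 2%:R^-1 ^+ r).
Proof.
have e m : 2%:R ^+ m != 0 :> R by rewrite expf_neq0 ?pnatr_eq0.
have e4 : 4%:R ^+ a != 0 :> R by rewrite expf_neq0 ?pnatr_eq0.
by rewrite /tilt exprVn; field; rewrite ?e ?e4.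
Qed.

Lemma sum_half (r0 N : nat) : \sum_(r < N | (r0 <= r)%N) 2%:R^-1 ^+ r <= 2%:R * 2%:R^-1 ^+ r0 :> R.
Proof.
have : 0 <= (2%:R^-1 : R) < 1 by lra.
move/(geometric_tail r0 N) => hg; apply: le_trans hg _.
by rewrite (_ : 1 - 2%:R^-1 = 2%:R^-1) ?invrK 1?mulrC //; field.
Qed.

(** A vertex is active from [r = rank] on, so summing [2 ^ -r] over those groups leaves about
    [2 ^ -rank]. This factor turns the height in the code length into the ratio of the two
    levels. *)
Lemma rank_bound a u : (a <= lvl u)%N ->
  (k u).+1%:R * 2%:R^-1 ^+ rank d k a u <= 2%:R * 2%:R ^+ (lvl u - a) :> R.
Proof.
move=> al; rewrite exprVn ler_pdivrMr ?exprn_gt0 // -mulrA -exprD -!natrX -natrM ler_nat.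
have : (k u <= 2 ^ (lvl u - a + rank d k a u))%N.
  apply: leq_trans (up_logP (k u) (isT : 1 < 2)%N) _.
  by rewrite leq_exp2l // /rank; lia.
have : (0 < 2 ^ (lvl u - a + rank d k a u))%N by rewrite expn_gt0.
lia.
Qed.

Lemma sum_code_length A r0 :
  \sum_(a < A) \sum_(r < r0) (tilt R D a r)^-1 * code_length R d k a r
   <= 64%:R * q * (32%:R * (\sum_u 4%:R ^+ lvl u) + 6%:R * (\sum_(i < h) n%:R * 4%:R ^+ d i)).
Proof.
have E : \sum_(a < A) \sum_(r < r0) (tilt R D a r)^-1 * code_length R d k a r
  = 64%:R * q * \sum_(u : V) \sum_(a < A) \sum_(r < r0) 4%:R ^+ a * 2%:R^-1 ^+ r *
     (if active d k a r u then 4%:R * (k u).+1%:R else (16%:R ^+ (a - d u.1))^-1).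
  rewrite [in RHS]exchange_big mulr_sumr; apply: eq_bigr => a _ /=.
  rewrite [in RHS]exchange_big mulr_sumr; apply: eq_bigr => r _ /=.
  by rewrite tiltV /code_length -[in RHS]mulr_sumr mulrA.
rewrite E ler_wpM2l ?mulr_ge0 ?exprn_ge0 //.
have -> : \sum_(i < h) n%:R * 4%:R ^+ d i = \sum_(u : V) 4%:R ^+ d u.1 :> R.
  rewrite (sum_fibres (fun u => 4%:R ^+ d u.1)).
  by apply: eq_bigr => i _; rewrite /= sumr_const card_ord mulr_natl.
rewrite !mulr_sumr -big_split; apply: ler_sum => u _ /=.
have half0 (r : nat) : 0 <= 2%:R^-1 ^+ r :> R by rewrite exprn_ge0 ?invr_ge0.
(* [F1] is the active share; its sum over [a <= lvl u] is at most [32 * 4 ^ lvl u]. [F2] is the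
   inactive share; it decays geometrically on both sides of [a = d u.1] and sums to at most
   [16/3 * 4 ^ d u.1]. *)
pose F1 (a : nat) : R := if (a <= lvl u)%N then 16%:R * (2%:R ^+ lvl u * 2%:R ^+ a) else 0.
pose F2 (a : nat) : R := 2%:R * (4%:R ^+ a / 16%:R ^+ (a - d u.1)).
have hF a : \sum_(r < r0) 4%:R ^+ a * 2%:R^-1 ^+ r *
     (if active d k a r u then 4%:R * (k u).+1%:R else (16%:R ^+ (a - d u.1))^-1)
     <= F1 a + F2 a.
  have h1 (r : 'I_r0) : 4%:R ^+ a * 2%:R^-1 ^+ r *
     (if active d k a r u then 4%:R * (k u).+1%:R else (16%:R ^+ (a - d u.1))^-1)
     <= (if active d k a r u then 2%:R^-1 ^+ r else 0) * (4%:R ^+ a * (4%:R * (k u).+1%:R))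
       + 2%:R^-1 ^+ r * (4%:R ^+ a / 16%:R ^+ (a - d u.1)) :> R.
    have p1 : 0 <= 2%:R^-1 ^+ r * (4%:R ^+ a / 16%:R ^+ (a - d u.1)) :> R.
      by rewrite mulr_ge0 // divr_ge0 ?exprn_ge0.
    case: ifP => _; last by rewrite mul0r add0r mulrAC mulrC.
    by rewrite -[leLHS]addr0 lerD // mulrAC mulrC mulrA.
  apply: le_trans (ler_sum _ (fun r _ => h1 r)) _.
  rewrite big_split /= -!mulr_suml lerD //; last first.
    rewrite ler_wpM2r ?divr_ge0 ?exprn_ge0 //.
    have := sum_half 0 r0; rewrite expr0 mulr1 => hh; apply: le_trans hh.
    by rewrite (eq_bigl xpredT).
  rewrite /F1 /active; case: leqP => al /=; last by rewrite big1 ?mul0r.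
  rewrite -big_mkcond /=.
  apply: le_trans (ler_wpM2r _ (sum_half _ _)) _; first by rewrite !mulr_ge0 ?exprn_ge0.
  have e4 : 4%:R ^+ a = 2%:R ^+ a * 2%:R ^+ a :> R.
    by rewrite -exprMn; congr (_ ^+ _); ring.
  have -> : 2%:R ^+ lvl u = 2%:R ^+ (lvl u - a) * 2%:R ^+ a :> R.
    by rewrite -exprD subnK.
  have := rank_bound al; set X := _ ^+ rank _ _ _ _ => hb.
  rewrite e4; set Y := 2%:R ^+ a; set Z := _ ^+ (_ - _) in hb *.
  have Y0 : 0 <= Y * Y by rewrite -expr2 sqr_ge0.
  rewrite (_ : 2%:R * X * _ = 8%:R * (Y * Y) * ((k u).+1%:R * X)); last by ring.
  rewrite (_ : 16%:R * _ = 8%:R * (Y * Y) * (2%:R * Z)); last by ring.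
  by rewrite ler_wpM2l // mulr_ge0.
apply: le_trans (ler_sum _ (fun (a : 'I_A) _ => hF a)) _.
rewrite big_split /= lerD //.
  rewrite /F1 -big_mkcond /= -mulr_sumr -mulr_sumr.
  have h2 : 1 < 2%:R :> R by lra.
  have := geometric_upto (lvl u) A h2.
  rewrite (_ : 2%:R - 1 = 1 :> R); last by ring.
  rewrite divr1 exprS; set S := \sum_(_ < _ | _) _ => hS.
  have -> : 4%:R ^+ lvl u = 2%:R ^+ lvl u * 2%:R ^+ lvl u :> R.
    by rewrite -exprMn; congr (_ ^+ _); ring.
  have := ler_wpM2l (exprn_ge0 (lvl u) (ler0n R 2)) hS.
  by set X := _ ^+ lvl u; lra.
rewrite /F2 -mulr_sumr; set dd := d u.1.
have h4 : 1 < 4%:R :> R by lra.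
have h14 : 0 <= (4%:R^-1 : R) < 1 by lra.
have b1 := geometric_upto dd A h4; have b2 := geometric_tail dd A h14.
have : \sum_(a < A) 4%:R ^+ a / 16%:R ^+ (a - dd)
  <= \sum_(a < A | (a <= dd)%N) 4%:R ^+ a + 16%:R ^+ dd * \sum_(a < A | (dd <= a)%N) 4%:R^-1 ^+ a :> R.
  rewrite mulr_sumr [X in _ <= X + _]big_mkcond [X in _ <= _ + X]big_mkcond -big_split.
  apply: ler_sum => a _ /=; case: (leqP a dd) => ad.
    rewrite (eqP (_ : a - dd == 0)%N) ?subn_eq0 // expr0 divr1 lerDl.
    by case: ifP => // _; rewrite mulr_ge0 ?exprn_ge0 ?invr_ge0.
  rewrite (ltnW ad) add0r ler_pdivrMr ?exprn_gt0 // mulrAC -exprD subnKC ?(ltnW ad) //.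
  by rewrite -exprMn (_ : 16%:R * _ = 4%:R) //; field.
have e16 : 16%:R ^+ dd = 4%:R ^+ dd * 4%:R ^+ dd :> R.
  by rewrite -exprMn; congr (_ ^+ _); ring.
have p4 : 0 < 4%:R ^+ dd :> R by rewrite exprn_gt0.
have : 16%:R ^+ dd * \sum_(a < A | (dd <= a)%N) 4%:R^-1 ^+ a <= 4%:R ^+ dd * (4%:R / 3%:R) :> R.
  apply: le_trans (ler_wpM2l _ b2) _; first by rewrite exprn_ge0.
  rewrite e16 exprVn le_eqVlt; apply/orP; left; apply/eqP.
  by field; rewrite gt_eqF.
have : 4%:R ^+ dd.+1 / (4%:R - 1) = 4%:R ^+ dd * (4%:R / 3%:R) :> R.
  by rewrite exprS; field.
move=> e; rewrite e in b1; move: b1.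
set X := \sum_(_ < _ | (_ <= dd)%N) _; set Y := _ * \sum_(_ < _ | _) _; set Z := \sum_(_ < _) _.
by lra.
Qed.

(** The levels and ranks of a pair determine [a] and [r], so the groups are disjoint; only the range
    of the indices has to be recorded. *)
Lemma sum_pair_in_group A r0 u v :
  \sum_(a < A) \sum_(r < r0) (pair_in_group D d k a r u v)%:R
   = [&& near_levels D d k u v, (minn (lvl u) (lvl v) < A)%N
       & (maxn (rank d k (minn (lvl u) (lvl v)) u) (rank d k (minn (lvl u) (lvl v)) v) < r0)%N]%:R :> R.
Proof.
have one N (P : nat -> bool) (b : nat) :
    \sum_(i < N) ((i == b :> nat) && P i)%:R = ((b < N)%N && P b)%:R :> R.
  case: (ltnP b N) => bN /=; last first.
    by apply: big1 => i _; case: eqP => // e; move: (ltn_ord i); rewrite e ltnNge bN.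
  rewrite (bigD1 (Ordinal bN)) //= eqxx big1 ?addr0 // => i.
  by rewrite -val_eqE /= => /negPf->.
rewrite /pair_in_group; case: near_levels => /=; last by rewrite big1 // => a _; rewrite big1.
set a0 := minn _ _.
rewrite (eq_bigr (fun a : 'I_A => ((a == a0 :> nat) && (maxn (rank d k a u) (rank d k a v) < r0)%N)%:R)).
  exact: (one A (fun a => (maxn (rank d k a u) (rank d k a v) < r0)%N) a0).
move=> a _; case: eqP => e /=; last by rewrite big1.
rewrite -[in RHS](andbT (_ < _)%N) -(one r0 (fun=> true) (maxn _ _)).
by apply: eq_bigr => r _; rewrite andbT.
Qed.

Section Signs.
Variables (sg tau : V -> R).
Hypotheses (sg1 : forall u, `|sg u| <= 1) (tau1 : forall u, `|tau u| <= 1).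
Local Notation pw := (pair_weight d k sg tau).
Local Notation coef := (group_coef D d k sg tau).

Lemma normr_pair_weight u v : `|pw u v| <= 2%:R ^+ lvl u * 2%:R ^+ lvl v.
Proof.
rewrite /pair_weight normrM [X in X * _]ger0_norm ?mulr_ge0 ?exprn_ge0 //.
rewrite ler_piMr ?mulr_ge0 ?exprn_ge0 // normrM normfV [`|2%:R|]ger0_norm //.
rewrite ler_pdivrMr // mul1r; apply: le_trans (ler_normD _ _) _.
have m1 (x y : R) : `|x| <= 1 -> `|y| <= 1 -> `|x * y| <= 1.
  by move=> hx hy; rewrite normrM mulr_ile1.
by have := m1 _ _ (sg1 u) (tau1 v); have := m1 _ _ (sg1 v) (tau1 u); lra.
Qed.

(* Either the rank of the lower vertex dominates and [2 ^ r <= 2 k u], or that of the upper vertex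
   does and [2 ^ r * 2 ^ (lvl v - lvl u) <= 2 k v]; the exponential is at most [2 ^ k] in both
   cases, so [4 ^ k] has room for everything, and it has bounded mean on each fibre. *)
Lemma pair_cost_le a r u v : (lvl u <= lvl v)%N -> pair_in_group D d k a r u v ->
  2%:R ^+ r * 4%:R ^+ lvl v * expR (2%:R ^+ r * 2%:R ^+ (lvl v - lvl u) / (8%:R * q))
   <= 8%:R * (4%:R ^+ lvl v * 4%:R ^+ k u + 4%:R ^+ lvl u * 4%:R ^+ k v).
Proof.
move=> luv /and3P[/andP[_ hD] /eqP ea /eqP er].
rewrite (minn_idPl luv) in ea.
have qe : 2%:R ^+ (lvl v - lvl u) <= q by rewrite ler_weXn2l ?ler1n //; lia.
have q1 : 1 <= q by rewrite exprn_ege1 // ler1n.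
have p4 m : 0 < 4%:R ^+ m :> R by rewrite exprn_gt0.
have p2 m : 0 < 2%:R ^+ m :> R by rewrite exprn_gt0.
have e4 m : 4%:R ^+ m = 2%:R ^+ m * 2%:R ^+ m :> R.
  by rewrite -exprMn; congr (_ ^+ _); ring.
have q0 : 0 < 8%:R * q by rewrite mulr_gt0.
have [hr|hr] := leqP (rank d k a v) (rank d k a u).
  have {}er : r = up_log 2 (k u) by rewrite er (maxn_idPl hr) /rank ea subnn subn0.
  have Kle : 2%:R ^+ r * 2%:R ^+ (lvl v - lvl u) / (8%:R * q) <= 2%:R ^+ r / 8%:R :> R.
    rewrite ler_pdivrMr // (_ : _ / _ * _ = 2%:R ^+ r * q); last by field.
    by rewrite ler_wpM2l // ltW.
  have hE : 2%:R ^+ r * expR (2%:R ^+ r / 8%:R) <= 8%:R * 4%:R ^+ k u :> R.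
    have [k0|kp] := posnP (k u).
      rewrite er k0 up_log0 /= !expr0 !mul1r.
      have := @expR_le_quadratic R (1 / 8%:R); rewrite mul1r ger0_norm ?invr_ge0 //.
      by move=> h8; apply: le_trans (h8 _) _; lra.
    have Ku : 2%:R ^+ r <= 2%:R * (k u)%:R :> R.
      by rewrite er -natrX -natrM ler_nat leq_pow2_up_log.
    have Eu : expR (2%:R ^+ r / 8%:R) <= 2%:R ^+ k u :> R.
      by apply: le_trans (expR_quarter R (k u)); rewrite ler_expR; lra.
    have ku : (k u)%:R <= 2%:R ^+ k u :> R by rewrite -natrX ler_nat; apply/ltnW/ltn_expl.
    have : 2%:R ^+ r * expR (2%:R ^+ r / 8%:R) <= 2%:R * (k u)%:R * 2%:R ^+ k u :> R.
      by apply: ler_pM => //; rewrite ?expR_ge0 // ltW.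
    by rewrite e4; have := p2 (k u); nra.
  have hx : expR (2%:R ^+ r * 2%:R ^+ (lvl v - lvl u) / (8%:R * q)) <= expR (2%:R ^+ r / 8%:R).
    by rewrite ler_expR.
  have h1 : 2%:R ^+ r * 4%:R ^+ lvl v * expR (2%:R ^+ r * 2%:R ^+ (lvl v - lvl u) / (8%:R * q))
    <= 2%:R ^+ r * 4%:R ^+ lvl v * expR (2%:R ^+ r / 8%:R).
    by rewrite ler_wpM2l // mulr_ge0 // ltW.
  apply: le_trans h1 _; rewrite mulrAC.
  apply: le_trans (ler_wpM2r (ltW (p4 _)) hE) _.
  rewrite mulrDr -[leLHS]addr0 lerD //; last by rewrite !mulr_ge0 ?exprn_ge0.
  by rewrite -mulrA [4%:R ^+ k u * _]mulrC.
have er' : r = rank d k a v by rewrite er (maxn_idPr _) // ltnW.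
have kv0 : (0 < k v)%N by move: hr; rewrite /rank; case: (k v) => //; rewrite up_log0; lia.
(* The rank of [v] exceeds that of [u], so it is positive and the truncated subtraction defining it
   is exact. *)
have eK : 2%:R ^+ r * 2%:R ^+ (lvl v - lvl u) = 2%:R ^+ up_log 2 (k v) :> R.
  rewrite -exprD; congr (_ ^+ _); move: hr; rewrite er' {2}/rank ea /rank; lia.
have Kv : 2%:R ^+ up_log 2 (k v) <= 2%:R * (k v)%:R :> R.
  by rewrite -natrX -natrM ler_nat leq_pow2_up_log.
rewrite eK.
have Ev : expR (2%:R ^+ up_log 2 (k v) / (8%:R * q)) <= 2%:R ^+ k v :> R.
  apply: le_trans (expR_quarter R (k v)); rewrite ler_expR ler_pdivrMr //.
  have : 0 <= (k v)%:R :> R by [].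
  by nra.
have e1 : 2%:R ^+ r * 4%:R ^+ lvl v = 2%:R ^+ up_log 2 (k v) * 2%:R ^+ (lvl v - lvl u) * 4%:R ^+ lvl u :> R.
  by rewrite -eK -{1}(subnK luv) exprD !e4; ring.
have e2 : 2%:R ^+ (lvl v - lvl u) <= 2%:R * (k v)%:R :> R.
  apply: le_trans Kv; rewrite -eK ler_peMl ?(ltW (p2 _)) //.
  by rewrite exprn_ege1 // ler1n.
have k2 : (k v)%:R ^+ 2 <= 2%:R * 2%:R ^+ k v :> R.
  by rewrite -!natrX -natrM ler_nat leq_sqr_pow2.
rewrite e1; apply: le_trans (_ : 4%:R * (k v)%:R ^+ 2 * 4%:R ^+ lvl u * 2%:R ^+ k v <= _).
  apply: ler_pM; rewrite ?expR_ge0 ?mulr_ge0 ?exprn_ge0 //.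
  rewrite ler_wpM2r ?exprn_ge0 //.
  rewrite (_ : 4%:R * _ = (2%:R * (k v)%:R) * (2%:R * (k v)%:R)); last by ring.
  by apply: ler_pM; rewrite ?exprn_ge0.
rewrite mulrDr -[leLHS]add0r lerD //; first by rewrite !mulr_ge0 ?exprn_ge0.
rewrite (e4 (k v)) (_ : 4%:R * _ * _ * _ = (4%:R * 4%:R ^+ lvl u * 2%:R ^+ k v) * (k v)%:R ^+ 2); last by ring.
rewrite (_ : 8%:R * _ = (4%:R * 4%:R ^+ lvl u * 2%:R ^+ k v) * (2%:R * 2%:R ^+ k v)); last by ring.
by rewrite ler_wpM2l // !mulr_ge0 ?exprn_ge0.
Qed.

(** With [a = lvl u], the tilt turns the exponent into that of [pair_cost_le], and the quadratic
    term divided by the tilt into [2 ^ r * 4 ^ lvl v / (64 q)]. *)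
Lemma group_coef_cost_le a r u v : pair_in_group D d k a r u v ->
  (tilt R D a r)^-1 * (coef a r u v ^+ 2 * expR (8%:R * `|coef a r u v|))
   <= (8%:R * q)^-1 * (4%:R ^+ lvl v * 4%:R ^+ k u + 4%:R ^+ lvl u * 4%:R ^+ k v).
Proof.
wlog luv : u v / (lvl u <= lvl v)%N => [W|hg].
  have [luv|/ltnW lvu] := leqP (lvl u) (lvl v); first exact: W.
  by rewrite pair_in_groupC group_coefC addrC; apply: W.
have := pair_cost_le luv hg; case/and3P: (hg) => _ /eqP ea _.
rewrite (minn_idPl luv) in ea.
set E1 := expR _ => hE.
have t0 := tilt_gt0 a r; set t := tilt R D a r in t0 *.
have npw := normr_pair_weight u v.
have p2 m : 0 < 2%:R ^+ m :> R by rewrite exprn_gt0.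
have e4 m : 4%:R ^+ m = 2%:R ^+ m * 2%:R ^+ m :> R.
  by rewrite -exprMn; congr (_ ^+ _); ring.
have ec : coef a r u v = t * pw u v by rewrite /group_coef hg mulr1.
have hE1 : expR (8%:R * `|coef a r u v|) <= E1.
  rewrite ler_expR ec normrM (gtr0_norm t0).
  apply: le_trans (_ : 8%:R * (t * (2%:R ^+ lvl u * 2%:R ^+ lvl v)) <= _).
    by rewrite ler_wpM2l // ler_wpM2l // ltW.
  rewrite -{1}(subnK luv) exprD /t /tilt ea e4 le_eqVlt; apply/orP; left; apply/eqP.
  by field; rewrite !gt_eqF ?p2.
have hc : t^-1 * coef a r u v ^+ 2 <= t * (4%:R ^+ lvl u * 4%:R ^+ lvl v).
  have e (z : R) : t^-1 * (t * z) ^+ 2 = t * z ^+ 2 by field; rewrite gt_eqF.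
  rewrite ec e ler_wpM2l ?(ltW t0) //.
  rewrite -(real_normK (num_real (pw u v))) !e4.
  rewrite (_ : _ * _ * (_ * _) = (2%:R ^+ lvl u * 2%:R ^+ lvl v) ^+ 2); last by ring.
  by rewrite lerXn2r ?nnegrE ?mulr_ge0 ?exprn_ge0.
rewrite mulrA; apply: le_trans (_ : t * (4%:R ^+ lvl u * 4%:R ^+ lvl v) * E1 <= _).
  apply: ler_pM => //; rewrite ?expR_ge0 // mulr_ge0 ?sqr_ge0 // invr_ge0 ltW //.
have -> : t * (4%:R ^+ lvl u * 4%:R ^+ lvl v) = 2%:R ^+ r * 4%:R ^+ lvl v / (64%:R * q).
  rewrite /t /tilt ea; field.
  by rewrite !gt_eqF ?p2 // exprn_gt0.
rewrite (_ : 2%:R ^+ r * _ / _ * E1 = (64%:R * q)^-1 * (2%:R ^+ r * 4%:R ^+ lvl v * E1)); last by ring.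
apply: le_trans (ler_wpM2l _ hE) _; first by rewrite invr_ge0 mulr_ge0 // ltW.
rewrite le_eqVlt; apply/orP; left; apply/eqP.
by field; rewrite gt_eqF ?p2.
Qed.

(** Each pair is counted in at most one group. The fibre mass [5 n] cancels the [1 / n], the degree
    bound gives [maxdeg H / q <= q], and [780 = 624 / 8 * 10]. *)
Lemma sum_mgf_cost A r0 :
  \sum_(a < A) \sum_(r < r0) (tilt R D a r)^-1 * mgf_cost H (coef a r)
   <= 780%:R * q * \sum_u 4%:R ^+ lvl u.
Proof.
pose X u v : R := 4%:R ^+ lvl v * 4%:R ^+ k u + 4%:R ^+ lvl u * 4%:R ^+ k v.
have X0 u v : 0 <= X u v by rewrite addr_ge0 ?mulr_ge0 ?exprn_ge0.
have n0 : 0 < n%:R :> R by rewrite ltr0n.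
have q0 := q_gt0.
have E : \sum_(a < A) \sum_(r < r0) (tilt R D a r)^-1 * mgf_cost H (coef a r)
  = 624%:R / n%:R * \sum_u \sum_v (H u.1 v.1)%:R * \sum_(a < A) \sum_(r < r0)
      (tilt R D a r)^-1 * (coef a r u v ^+ 2 * expR (8%:R * `|coef a r u v|)).
  have -> : \sum_u \sum_v (H u.1 v.1)%:R * (\sum_(a < A) \sum_(r < r0)
      (tilt R D a r)^-1 * (coef a r u v ^+ 2 * expR (8%:R * `|coef a r u v|)))
     = \sum_u \sum_v \sum_(a < A) \sum_(r < r0) (H u.1 v.1)%:R *
      ((tilt R D a r)^-1 * (coef a r u v ^+ 2 * expR (8%:R * `|coef a r u v|))).
    apply: eq_bigr => u _; apply: eq_bigr => v _; rewrite mulr_sumr.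
    by apply: eq_bigr => a _; rewrite mulr_sumr.
  rewrite exchange_big_pairs mulr_sumr; apply: eq_bigr => a _.
  rewrite mulr_sumr; apply: eq_bigr => r _.
  rewrite /mgf_cost mulrAC mulrCA; congr (_ * _).
  rewrite mulr_sumr; apply: eq_bigr => u _; rewrite mulr_sumr; apply: eq_bigr => v _.
  by rewrite mulrCA.
rewrite E.
have hX u v : \sum_(a < A) \sum_(r < r0)
      (tilt R D a r)^-1 * (coef a r u v ^+ 2 * expR (8%:R * `|coef a r u v|))
    <= (8%:R * q)^-1 * X u v.
  have h1 (a : 'I_A) (r : 'I_r0) :
    (tilt R D a r)^-1 * (coef a r u v ^+ 2 * expR (8%:R * `|coef a r u v|))
     <= (8%:R * q)^-1 * X u v * (pair_in_group D d k a r u v)%:R.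
    have [hg|hg] := boolP (pair_in_group D d k a r u v).
      by rewrite mulr1; apply: group_coef_cost_le.
    by rewrite /group_coef (negPf hg) !mulr0 expr0n mul0r mulr0.
  apply: le_trans (ler_sum _ (fun a _ => ler_sum _ (fun r _ => h1 a r))) _.
  under eq_bigr => a _ do rewrite -mulr_sumr.
  rewrite -mulr_sumr sum_pair_in_group ler_piMr //; last by case: (_ && _).
  by rewrite mulr_ge0 // invr_ge0 mulr_ge0 // ltW.
have hs : \sum_u \sum_v (H u.1 v.1)%:R * X u v
    <= 10%:R * n%:R * (maxdeg H)%:R * \sum_u 4%:R ^+ lvl u.
  have sym : \sum_u \sum_v (H u.1 v.1)%:R * (4%:R ^+ lvl v * 4%:R ^+ k u)
     = \sum_u \sum_v (H u.1 v.1)%:R * (4%:R ^+ lvl u * 4%:R ^+ k v) :> R.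
    by rewrite exchange_big; apply: eq_bigr => u _; apply: eq_bigr => v _; rewrite Hsym.
  under eq_bigr => u _ do under eq_bigr => v _ do rewrite mulrDr.
  under eq_bigr => u _ do rewrite big_split /=.
  rewrite big_split /= sym.
  suff : \sum_u \sum_v (H u.1 v.1)%:R * (4%:R ^+ lvl u * 4%:R ^+ k v)
     <= 5%:R * n%:R * (maxdeg H)%:R * \sum_u 4%:R ^+ lvl u :> R by lra.
  rewrite mulr_sumr; apply: ler_sum => u _.
  rewrite (sum_fibres (fun v => (H u.1 v.1)%:R * (4%:R ^+ lvl u * 4%:R ^+ k v))) /=.
  apply: le_trans (_ : \sum_j (H u.1 j)%:R * (4%:R ^+ lvl u * (5%:R * n%:R)) <= _).
    apply: ler_sum => j _; rewrite -mulr_sumr ler_wpM2l //.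
    by rewrite -mulr_sumr ler_wpM2l ?exprn_ge0.
  rewrite -mulr_suml.
  apply: le_trans (ler_wpM2r _ (sum_base_degree u.1)) _.
    by rewrite !mulr_ge0 ?exprn_ge0.
  by rewrite le_eqVlt; apply/orP; left; apply/eqP; ring.
have hs2 : \sum_u \sum_v (H u.1 v.1)%:R * \sum_(a < A) \sum_(r < r0)
      (tilt R D a r)^-1 * (coef a r u v ^+ 2 * expR (8%:R * `|coef a r u v|))
    <= (8%:R * q)^-1 * \sum_u \sum_v (H u.1 v.1)%:R * X u v.
  rewrite mulr_sumr; apply: ler_sum => u _; rewrite mulr_sumr; apply: ler_sum => v _.
  by rewrite mulrCA ler_wpM2l.
apply: le_trans (ler_wpM2l _ hs2) _; first by rewrite divr_ge0.
apply: le_trans (ler_wpM2l _ (ler_wpM2l _ hs)) _.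
- by rewrite divr_ge0.
- by rewrite invr_ge0 mulr_ge0 // ltW.
set W := \sum_u _.
have W0 : 0 <= W by apply: sumr_ge0 => u _; rewrite exprn_ge0.
have -> : 624%:R / n%:R * ((8%:R * q)^-1 * (10%:R * n%:R * (maxdeg H)%:R * W))
   = 780%:R * ((maxdeg H)%:R / q) * W.
  by field; rewrite !gt_eqF.
rewrite ler_wpM2r // ler_wpM2l // ler_pdivrMr // -expr2 //.
Qed.

(** A pair goes to [Y] if its levels are far apart, to [G] if they are near and the lower one is
    below [A], and to [T] if both are at least [A]. The constants are [2830 = 64 * 32 + 780 + 2],
    [384 = 64 * 6] and [43 > 128 / 3]. *)
Lemma quadratic_form_bound (s : lift_space h n) A (eta : R) : 0 <= eta ->
  (forall a r, (a < A)%N -> (r < A + D)%N ->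
     deviation H (coef a r) s <= code_length R d k a r + mgf_cost H (coef a r) + eta) ->
  \sum_u \sum_v centered_adj R H s u v * pw u v
   <= q * (2830%:R * (\sum_u 4%:R ^+ lvl u) + 384%:R * (\sum_(i < h) n%:R * 4%:R ^+ d i)
           + 43%:R * 4%:R ^+ A * eta)
     + \sum_u \sum_v (if (A <= lvl u)%N && (A <= lvl v)%N then
          ((lift_adj H s u v)%:R + base_mean R H u v) * (2%:R ^+ lvl u * 2%:R ^+ lvl v) else 0).
Proof.
move=> eta0 hdev.
have q0 := q_gt0.
pose M u v : R := (lift_adj H s u v)%:R + base_mean R H u v.
have M0 u v : 0 <= M u v by rewrite addr_ge0 // /base_mean divr_ge0.
pose T u v := (if (A <= lvl u)%N && (A <= lvl v)%N then
          M u v * (2%:R ^+ lvl u * 2%:R ^+ lvl v) else 0).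
have T0 u v : 0 <= T u v.
  by rewrite /T; case: ifP => // _; rewrite !mulr_ge0 ?exprn_ge0.
pose Y u v := (2%:R * q)^-1 * (M u v * (4%:R ^+ lvl u + 4%:R ^+ lvl v)).
have Y0 u v : 0 <= Y u v.
  by rewrite mulr_ge0 ?invr_ge0 ?mulr_ge0 ?M0 ?addr_ge0 ?exprn_ge0.
have e4 m : 4%:R ^+ m = 2%:R ^+ m * 2%:R ^+ m :> R.
  by rewrite -exprMn; congr (_ ^+ _); ring.
have p2 m : 0 < 2%:R ^+ m :> R by rewrite exprn_gt0.
have hC u v : centered_adj R H s u v * pw u v <= M u v * (2%:R ^+ lvl u * 2%:R ^+ lvl v).
  apply: le_trans (ler_norm _) _; rewrite normrM.
  by apply: ler_pM => //; [apply: normr_centered_adj | apply: normr_pair_weight].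
pose G u v := \sum_(a < A) \sum_(r < A + D) (tilt R D a r)^-1 * (coef a r u v * centered_adj R H s u v).
have eG u v : G u v = centered_adj R H s u v * pw u v *
   \sum_(a < A) \sum_(r < A + D) (pair_in_group D d k a r u v)%:R.
  rewrite mulr_sumr; apply: eq_bigr => a _; rewrite mulr_sumr; apply: eq_bigr => r _.
  by rewrite /group_coef; field; rewrite gt_eqF ?tilt_gt0.
have far u v : (lvl u + D < lvl v)%N -> 2%:R ^+ lvl u * 2%:R ^+ lvl v
    <= (2%:R * q)^-1 * (4%:R ^+ lvl u + 4%:R ^+ lvl v).
  move=> luv; rewrite [leRHS]mulrC ler_pdivlMr ?mulr_gt0 // e4 (e4 (lvl v)).
  have : 2%:R ^+ lvl u * (2%:R * q) <= 2%:R ^+ lvl v.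
    by rewrite -exprS -exprD ler_weXn2l ?ler1n // addnS.
  have := p2 (lvl u); have := p2 (lvl v); nra.
have key u v : centered_adj R H s u v * pw u v <= Y u v + T u v + G u v.
  rewrite eG sum_pair_in_group.
  have [hn|hn] := boolP (near_levels D d k u v); last first.
    rewrite mulr0 addr0 -[leLHS]addr0 lerD //.
    apply: le_trans (hC u v) _; rewrite /Y [leRHS]mulrCA ler_wpM2l //.
    move: hn; rewrite negb_and -!ltnNge => /orP[|] hl; last exact: far.
    by rewrite mulrC addrC; apply: far.
  case: ltnP => hA /=; last first.
    rewrite mulr0 addr0 -[leLHS]add0r lerD // /T.
    by rewrite -leq_min hA.
  case: ltnP => hr /=; first by rewrite mulr1 lerDr addr_ge0.
  (* As [up_log 2 (k w) <= k w <= level d k w], all ranks that occur are below [A + D]; no near pair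
     with lower level below [A] escapes the groups. *)
  exfalso; move: hr; rewrite leqNgt => /negP; apply.
  case/andP: hn => h1 h2; set a := minn _ _ in hA *.
  have ru w : (lvl w <= a + D)%N -> (rank d k a w < A + D)%N.
    move=> hw; rewrite /rank; have := up_log2_le (k w).
    rewrite /level in hw *; lia.
  by rewrite gtn_max !ru // /a; case: (leqP (lvl u) (lvl v)) => ?; rewrite ?leqnn; lia.
apply: le_trans (ler_sum _ (fun u _ => ler_sum _ (fun v _ => key u v))) _.
under eq_bigr => u _ do rewrite !big_split /=.
rewrite !big_split /= addrAC lerD //.
set W := \sum_u 4%:R ^+ lvl u; set W1 := \sum_(i < h) _.
have W0 : 0 <= W by apply: sumr_ge0 => u _; rewrite exprn_ge0.
have hY : \sum_u \sum_v Y u v <= 2%:R * q * W.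
  have Mdeg u : \sum_v M u v <= 2%:R * (maxdeg H)%:R.
    by rewrite big_split /=; have := lift_adj_degree s u; have := base_mean_degree u; lra.
  have Msym u v : M u v = M v u by rewrite /M lift_adjC // /base_mean Hsym.
  have e1 : \sum_u \sum_v Y u v = q^-1 * \sum_u 4%:R ^+ lvl u * \sum_v M u v.
    have -> : \sum_u \sum_v Y u v = (2%:R * q)^-1 *
       (\sum_u \sum_v M u v * 4%:R ^+ lvl u + \sum_u \sum_v M u v * 4%:R ^+ lvl v).
      rewrite -big_split mulr_sumr; apply: eq_bigr => u _ /=.
      by rewrite -big_split mulr_sumr; apply: eq_bigr => v _ /=; rewrite -mulrDr.
    have -> : \sum_u \sum_v M u v * 4%:R ^+ lvl v = \sum_u \sum_v M u v * 4%:R ^+ lvl u.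
      by rewrite exchange_big; apply: eq_bigr => u _; apply: eq_bigr => v _; rewrite Msym.
    have -> : \sum_u \sum_v M u v * 4%:R ^+ lvl u = \sum_u 4%:R ^+ lvl u * \sum_v M u v.
      by apply: eq_bigr => u _; rewrite -mulr_suml mulrC.
    by field; rewrite gt_eqF.
  rewrite e1; apply: le_trans (_ : q^-1 * (W * (2%:R * (maxdeg H)%:R)) <= _).
    rewrite ler_wpM2l ?invr_ge0 ?(ltW q0) // mulr_suml; apply: ler_sum => u _.
    by rewrite ler_wpM2l ?exprn_ge0.
  rewrite mulrC ler_pdivrMr //.
  have := ler_wpM2l W0 degq; lra.
have hG : \sum_u \sum_v G u v = \sum_(a < A) \sum_(r < A + D) (tilt R D a r)^-1 * deviation H (coef a r) s.
  rewrite /G exchange_big_pairs; apply: eq_bigr => a _; apply: eq_bigr => r _.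
  by rewrite mulr_sumr; apply: eq_bigr => u _; rewrite mulr_sumr.
have hG2 : \sum_u \sum_v G u v <=
   \sum_(a < A) \sum_(r < A + D) (tilt R D a r)^-1 * (code_length R d k a r + mgf_cost H (coef a r) + eta).
  rewrite hG; apply: ler_sum => a _; apply: ler_sum => r _.
  by rewrite ler_wpM2l ?hdev // invr_ge0 ltW // tilt_gt0.
have c1 := sum_code_length A (A + D).
have c2 := sum_mgf_cost A (A + D).
have c3 : \sum_(a < A) \sum_(r < A + D) (tilt R D a r)^-1 * eta <= q * (43%:R * 4%:R ^+ A * eta).
  have hr (a : 'I_A) : \sum_(r < A + D) (tilt R D a r)^-1 * eta <= 128%:R * q * eta * 4%:R ^+ a.
    have := sum_half 0 (A + D); rewrite expr0 mulr1 => hh.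
    rewrite -mulr_suml; under eq_bigr => r _ do rewrite tiltV.
    rewrite -mulr_sumr -mulr_sumr.
    move: hh; rewrite (eq_bigl xpredT) //; set S := \sum_(_ < _) _ => hS.
    have : 0 <= q * eta * 4%:R ^+ a by rewrite !mulr_ge0 ?exprn_ge0.
    by move/(ler_wpM2l)/(_ _ _ hS); lra.
  apply: le_trans (ler_sum _ (fun a _ => hr a)) _; rewrite -mulr_sumr.
  have h4 : 1 < 4%:R :> R by lra.
  case: (posnP A) => [A0|Ap]; first by subst A; rewrite big_ord0 mulr0 !mulr_ge0 ?exprn_ge0 // ltW.
  have := geometric_upto A.-1 A h4; rewrite prednK // (_ : 4%:R - 1 = 3%:R :> R); last by ring.
  rewrite (eq_bigl xpredT) => [|a]; last by have := ltn_ord a; lia.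
  set S := \sum_(_ < _) _ => hS.
  have : 0 <= q * eta by rewrite mulr_ge0 // ltW.
  move/(ler_wpM2l)/(_ _ _ hS); have : 0 <= q * eta * 4%:R ^+ A by rewrite !mulr_ge0 ?exprn_ge0 // ltW.
  by lra.
have hsum : \sum_(a < A) \sum_(r < A + D) (tilt R D a r)^-1 * (code_length R d k a r + mgf_cost H (coef a r) + eta)
  = \sum_(a < A) \sum_(r < A + D) (tilt R D a r)^-1 * code_length R d k a r
  + \sum_(a < A) \sum_(r < A + D) (tilt R D a r)^-1 * mgf_cost H (coef a r)
  + \sum_(a < A) \sum_(r < A + D) (tilt R D a r)^-1 * eta.
  rewrite -!big_split; apply: eq_bigr => a _ /=; rewrite -!big_split; apply: eq_bigr => r _ /=.
  by rewrite !mulrDr.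
rewrite hsum in hG2; rewrite -/W -/W1 in c1 c2; lra.
Qed.

End Signs.
End Deterministic.

(** * Sparsity of small vertex sets *)

Section SparseSubsets.
Variable R : realType.
Local Open Scope ring_scope.

Lemma bin_exp_le (N t : nat) : ('C(N, t) * t`! <= N ^ t)%N.
Proof.
rewrite bin_ffact; elim: t => [|t IH]; first by rewrite ffactn0.
by rewrite ffactnSr expnSr leq_mul // leq_subr.
Qed.

Lemma exp_fact_le (t : nat) : t%:R ^+ t <= expR t%:R * t`!%:R :> R.
Proof.
case: t => [|t]; first by rewrite expr0 fact0 mulr1 expR0.
have := @expR_ge1Dxn R t.+1%:R t (ler0n R t.+1).
rewrite -ler_pdivrMr ?ltr0n ?fact_gt0 // => le1; apply: le_trans le1.
by rewrite lerDr.
Qed.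

Lemma sum_card_partition (T : finType) (F : nat -> R) :
  \sum_(S : {set T}) F #|S| = \sum_(t < #|T|.+1) 'C(#|T|, t)%:R * F t.
Proof.
rewrite (partition_big (fun S : {set T} => inord #|S| : 'I_#|T|.+1) xpredT) //=.
apply: eq_bigr => t _.
have e (S : {set T}) : (inord #|S| == t) = (#|S| == t).
  by rewrite -val_eqE /= inordK // ltnS max_card.
rewrite (eq_bigr (fun=> F t)) => [|S]; last by rewrite e => /eqP->.
rewrite sumr_const -[F t *+ _]mulr_natl; congr (_%:R * _).
rewrite -card_draws -sum1_card -[in RHS]sum1_card; apply: eq_bigl => S.
by rewrite inE -e.
Qed.

Variables (h : nat) (H : rel 'I_h).
Hypotheses (Hsym : symmetric H) (Hirr : irreflexive H).

(** There are at most [(h n)^t / t! <= (expR 1 * h n / t)^t] sets of size [t], each of weight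
    [(t / n * expR (- (2 h + 1)))^t]. Since [h * expR (- 2 h) <= 1/2], size [t] contributes at most
    [2 ^ -t]. *)
Lemma subset_kraft n : (0 < n)%N ->
  \sum_(S : {set 'I_h * 'I_n} | (0 < #|S|)%N)
     expR (- (#|S|%:R * (ln (n%:R / #|S|%:R) + (2 * h + 1)%:R))) <= 1 :> R.
Proof.
move=> n0; have np : 0 < n%:R :> R by rewrite ltr0n.
pose F t : R := if (0 < t)%N then expR (- (t%:R * (ln (n%:R / t%:R) + (2 * h + 1)%:R))) else 0.
rewrite big_mkcond (eq_bigr (fun S : {set 'I_h * 'I_n} => F #|S|)) // sum_card_partition.
have hF t : 'C(#|{: 'I_h * 'I_n}|, t)%:R * F t <= (if (1 <= t)%N then 2%:R^-1 ^+ t else 0).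
  rewrite /F; case: ifP => t0; last by rewrite mulr0.
  have tp : 0 < t%:R :> R by rewrite ltr0n.
  have fp : 0 < t`!%:R :> R by rewrite ltr0n fact_gt0.
  have e1 : expR (- (t%:R * (ln (n%:R / t%:R) + (2 * h + 1)%:R)))
      = (t%:R / n%:R * expR (- (2 * h + 1)%:R)) ^+ t :> R.
    rewrite -mulrN expRM_natl opprD expRD expRN lnK ?posrE ?divr_gt0 //.
    by rewrite invf_div.
  have hb : 'C(#|{: 'I_h * 'I_n}|, t)%:R * t`!%:R <= (h%:R * n%:R) ^+ t :> R.
    by rewrite -!natrM -natrX ler_nat card_prod !card_ord bin_exp_le.
  have hh : h%:R * expR (- (2 * h)%:R) <= 2%:R^-1 :> R.
    rewrite expRN ler_pdivrMr ?expR_gt0 // natrM.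
    by have := expR_ge1Dx (2%:R * h%:R : R); lra.
  rewrite e1 -(ler_pM2r fp) mulrAC.
  apply: le_trans (ler_wpM2r _ hb) _.
    by rewrite exprn_ge0 // mulr_ge0 ?expR_ge0 ?divr_ge0.
  rewrite -exprMn (_ : h%:R * n%:R * _ = (h%:R * expR (- (2 * h + 1)%:R)) * t%:R); last first.
    by field; rewrite gt_eqF.
  rewrite exprMn; apply: le_trans (ler_wpM2l _ (exp_fact_le t)) _.
    by rewrite exprn_ge0 // mulr_ge0 ?expR_ge0.
  have et : expR t%:R = expR 1 ^+ t :> R by rewrite -expRM_natl mulr1.
  rewrite mulrA ler_wpM2r ?(ltW fp) // et -exprMn.
  rewrite lerXn2r ?nnegrE ?mulr_ge0 ?expR_ge0 ?invr_ge0 //.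
  by rewrite -mulrA -expRD natrD opprD -addrA addNr addr0.
apply: le_trans (ler_sum _ (fun (t : 'I_#|{: 'I_h * 'I_n}|.+1) _ => hF t)) _.
rewrite -big_mkcond /=.
have h2 : 0 <= (2%:R^-1 : R) < 1 by lra.
apply: le_trans (geometric_tail _ _ h2) _.
rewrite expr1 (_ : 1 - 2%:R^-1 = 2%:R^-1); last by field.
by rewrite divff // invr_eq0 pnatr_eq0.
Qed.

(** Chernoff bound for the edges inside [S], united over [S] by [subset_kraft]. The sum runs over
    ordered pairs, so each edge counts twice. *)
Lemma card_dense_subset_event (Q : nat) : exists2 eps : R, 0 < eps & forall n, (0 < n)%N ->
  #|[set s : lift_space h n | [exists S : {set 'I_h * 'I_n}, (#|S|%:R <= eps * n%:R) &&
      ((20 * #|S| + 10 * Q + 10)%:R < \sum_(u in S) \sum_(v in S) (lift_adj H s u v)%:R :> R)]]|%:R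
   <= #|lift_space h n|%:R / n%:R ^+ Q.+1 :> R.
Proof.
pose c0 : R := (2 * h + 1)%:R.
exists (expR (- (314%:R + c0 + Q%:R))); first exact: expR_gt0.
move=> n n0; have np : 0 < n%:R :> R by rewrite ltr0n.
pose l (S : {set 'I_h * 'I_n}) : R := #|S|%:R * (ln (n%:R / #|S|%:R) + c0).
(* The parameter is such that [expR (5 th) = n / t]. As [th^2 <= 2 expR th], the second order term
   [t^2 th^2 expR (4 th) / n] is then [O(t)]. *)
pose th (S : {set 'I_h * 'I_n}) : R := ln (n%:R / #|S|%:R) / 5%:R.
pose c (S : {set 'I_h * 'I_n}) (u v : 'I_h * 'I_n) : R :=
  if (u \in S) && (v \in S) then th S / 2%:R else 0.
pose Z S (s : lift_space h n) : R := deviation H (c S) s - mgf_cost H (c S).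
have hZ S : \sum_s expR (Z S s) <= #|lift_space h n|%:R.
  under eq_bigr => s _ do rewrite /Z expRD.
  rewrite -mulr_suml.
  have csym u v : c S u v = c S v u by rewrite /c andbC.
  have := deviation_mgf Hsym Hirr csym.
  move/(ler_wpM2r (expR_ge0 (- mgf_cost H (c S)))) => hh; apply: le_trans hh _.
  by rewrite -mulrA expRxMexpNx_1 mulr1.
have := card_exists_exp (ln (n%:R ^+ Q.+1)) (subset_kraft n0) hZ.
rewrite expRN lnK ?posrE ?exprn_gt0 //; apply: le_trans.
rewrite ler_nat; apply/subset_leq_card/subsetP => s; rewrite !inE.
case/existsP => S /andP[hS hd]; apply/existsP; exists S.
have S0 : (0 < #|S|)%N.
  rewrite lt0n; apply: contraTN hd => /eqP S0; rewrite -leNgt.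
  by rewrite (cards0_eq S0) big_set0.
rewrite S0 /=.
set t := #|S| in S0 hS hd *; have tp : 0 < t%:R :> R by rewrite ltr0n.
have t1 : 1 <= t%:R :> R by rewrite ler1n.
set L := ln (n%:R / t%:R).
have hL : 314%:R + c0 + Q%:R <= L.
  rewrite /L -ler_expR lnK ?posrE ?divr_gt0 // ler_pdivlMr //.
  move: hS; rewrite expRN mulrC ler_pdivlMr ?expR_gt0 // mulrC; done.
have c00 : 0 <= c0 by rewrite /c0.
have Q0 : 0 <= Q%:R :> R by [].
have eth : th S = L / 5%:R by [].
have th0 : 0 <= th S by rewrite eth; lra.
have th2 : 0 <= th S / 2%:R by lra.
have e5 : expR (th S) ^+ 5 = n%:R / t%:R.
  by rewrite -expRM_natl eth mulrC divfK ?pnatr_eq0 // /L lnK ?posrE ?divr_gt0.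
have eg1 : 1 + th S <= expR (th S) := expR_ge1Dx _.
have eg2 : th S ^+ 2 / 2%:R <= expR (th S).
  by have := @expR_ge1Dxn R _ 1 th0; rewrite (_ : 2`! = 2)%N //; lra.
have sumS (a : R) : \sum_u \sum_v (if (u \in S) && (v \in S) then a else 0) = t%:R * t%:R * a.
  have -> : \sum_u \sum_v (if (u \in S) && (v \in S) then a else 0)
     = \sum_(u in S) \sum_(v in S) a.
    rewrite [RHS]big_mkcond; apply: eq_bigr => u _; case: (u \in S) => /=; last by rewrite big1.
    by rewrite [RHS]big_mkcond.
  by rewrite !sumr_const -mulrA !mulr_natl.
have hmgf : mgf_cost H (c S) <= 312%:R * t%:R.
  have h1 : mgf_cost H (c S) <= 624%:R * (t%:R * t%:R * ((th S / 2%:R) ^+ 2 * expR (th S) ^+ 4)) / n%:R.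
    rewrite /mgf_cost ler_wpM2r ?invr_ge0 // ler_wpM2l // -sumS.
    apply: ler_sum => u _; apply: ler_sum => v _; rewrite /c; case: ifP => _.
      rewrite ger0_norm // (_ : 8%:R * _ = 4%:R * th S); last by field.
      rewrite expRM_natl ler_piMl //; last by case: (H _ _).
      by apply: mulr_ge0; [apply: sqr_ge0 | apply/exprn_ge0/expR_ge0].
    by rewrite expr0n /= mul0r mulr0.
  apply: le_trans h1 _; rewrite ler_pdivrMr //.
  have e4 : 0 <= expR (th S) ^+ 4 by rewrite exprn_ge0 ?expR_ge0.
  have h2 : (th S / 2%:R) ^+ 2 * expR (th S) ^+ 4 <= n%:R / t%:R / 2%:R.
    rewrite -e5 (exprS _ 4); set E4 := expR (th S) ^+ 4 in e4 *.
    have := ler_wpM2r e4 eg2; lra.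
  have := ler_wpM2l (mulr_ge0 (ltW tp) (ltW tp)) h2.
  have -> : t%:R * t%:R * (n%:R / t%:R / 2%:R) = t%:R * n%:R / 2%:R :> R.
    by field; rewrite gt_eqF.
  by lra.
have hmean : \sum_u \sum_v c S u v * base_mean R H u v <= t%:R / 2%:R.
  have h1 : \sum_u \sum_v c S u v * base_mean R H u v <= t%:R * t%:R * (th S / 2%:R / n%:R).
    rewrite -sumS; apply: ler_sum => u _; apply: ler_sum => v _; rewrite /c; case: ifP => _.
      rewrite ler_wpM2l // /base_mean ler_piMl ?invr_ge0 //.
      by case: (H _ _).
    by rewrite mul0r.
  apply: le_trans h1 _.
  have h2 : th S <= n%:R / t%:R.
    rewrite -e5; apply: le_trans (_ : expR (th S) <= _); first by lra.
    by rewrite ler_eXnr //; lra.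
  have := ler_wpM2l (mulr_ge0 (ltW tp) (ltW tp)) h2.
  rewrite (_ : t%:R * t%:R * (n%:R / t%:R) = t%:R * n%:R :> R); last first.
    by field; rewrite gt_eqF.
  move=> h3; rewrite (_ : _ * _ * (_ / _ / _) = t%:R * t%:R * th S / 2%:R / n%:R); last by ring.
  by rewrite ler_pdivrMr //; lra.
have hadj : \sum_u \sum_v c S u v * (lift_adj H s u v)%:R
    = th S / 2%:R * \sum_(u in S) \sum_(v in S) (lift_adj H s u v)%:R.
  rewrite mulr_sumr [RHS]big_mkcond; apply: eq_bigr => u _.
  rewrite /c; case: (u \in S) => /=; last by rewrite big1 // => v _; rewrite mul0r.
  rewrite mulr_sumr [RHS]big_mkcond; apply: eq_bigr => v _.
  by case: (v \in S); rewrite ?mul0r.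
have hdev : deviation H (c S) s = \sum_u \sum_v c S u v * (lift_adj H s u v)%:R
    - \sum_u \sum_v c S u v * base_mean R H u v.
  rewrite -sumrB; apply: eq_bigr => u _; rewrite -sumrB; apply: eq_bigr => v _.
  by rewrite -mulrBr.
have lnn : ln (n%:R ^+ Q.+1) = Q.+1%:R * (L + ln t%:R).
  rewrite lnXn // -[ln _ *+ _]mulr_natl; congr (_ * _).
  by rewrite /L ln_div ?posrE // subrK.
have lnt : ln t%:R <= t%:R :> R by apply/ltW/ln_sublinear.
(* Beyond the threshold the edge term exceeds [2 t L + (Q + 1) L]. It must beat [t (L + c0) + 312 t
   + t / 2 + (Q + 1) (L + ln t)], which follows from [ln t <= t] and [L >= 314 + c0 + Q]. *)
rewrite /Z hdev hadj lnn -/L.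
have thp : 0 < L / 5%:R / 2%:R by lra.
have := hd; rewrite -(ltr_pM2l thp) eth => hd2.
have hL2 := ler_wpM2l (ltW tp) hL.
have Q1 : 0 <= Q.+1%:R :> R by [].
have hQ := ler_wpM2l Q1 lnt.
have eQ : (20 * t + 10 * Q + 10)%:R = 20%:R * t%:R + 10%:R * Q.+1%:R :> R.
  by rewrite -[Q.+1]addn1 !(natrD, natrM); ring.
rewrite eQ in hd2; rewrite -[Q%:R]/(Q%:R) in hL2.
have eQ1 : Q.+1%:R = Q%:R + 1 :> R by rewrite natr1.
rewrite eQ1 in hd2 hQ *.
set X := \sum_(u in S) _ in hd2 *.
by lra.
Qed.

End SparseSubsets.

(** * Peeling vertices of small degree *)

Section Peeling.
Variable R : realType.
Local Open Scope ring_scope.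
Variables (T : finType) (e : rel T) (w : T -> R).
Hypotheses (esym : symmetric e) (eirr : irreflexive e).

Definition adj_form (S : {set T}) : R := \sum_(u in S) \sum_(v in S) (e u v)%:R * (w u * w v).
Definition degree_in (S : {set T}) u : R := \sum_(v in S) (e u v)%:R.

Lemma sum_setD1 (S : {set T}) u (F : T -> R) : u \in S ->
  \sum_(v in S) F v = F u + \sum_(v in S :\ u) F v.
Proof.
move=> uS; rewrite (bigD1 u) //=; congr (_ + _).
by apply: eq_bigl => v; rewrite !inE andbC.
Qed.

(* Deleting a vertex [u] of degree below [m] changes the form by at most [m al (w u)^2] plus
   [(w v)^2 / al] for each neighbour [v], which is charged to the degree of [v]. *)
Lemma peel (m : nat) (al : R) (L : {set T}) : 0 < al ->
  exists S : {set T}, [/\ S \subset L, forall u, u \in S -> m%:R <= degree_in S u &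
    adj_form L <= adj_form S + m%:R * al * \sum_(u in L) w u ^+ 2
       + al^-1 * \sum_(u in L) degree_in L u * w u ^+ 2].
Proof.
move=> al0; move: {2}#|L| (leqnn #|L|) => N.
elim: N L => [|N IH] L cL.
  have L0 : L = set0 by apply: cards0_eq; apply/eqP; rewrite -leqn0.
  exists L; split => [|u|]; first exact: subxx.
    by rewrite L0 inE.
  by rewrite L0 !big_set0 !mulr0 !addr0.
have [/forallP hL|] := boolP [forall u, (u \in L) ==> (m%:R <= degree_in L u)].
  exists L; split => [|u uL|]; first exact: subxx.
    by have := hL u; rewrite uL.
  rewrite -addrA lerDl addr_ge0 // mulr_ge0 ?invr_ge0 ?mulr_ge0 // ?(ltW al0) //.
    by apply: sumr_ge0 => u _; apply: sqr_ge0.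
  by apply: sumr_ge0 => u _; rewrite mulr_ge0 ?sqr_ge0 //; apply: sumr_ge0.
rewrite negb_forall => /existsP[u]; rewrite negb_imply -ltNge => /andP[uL hdeg].
have cL' : (#|L :\ u| <= N)%N by rewrite (cardsD1 u L) uL in cL.
have [S [SL hS hform]] := IH _ cL'.
exists S; split => //; first by apply: subset_trans SL (subD1set _ _).
set L' := L :\ u in hform.
have d0 : degree_in L u = degree_in L' u by rewrite /degree_in (sum_setD1 _ uL) eirr add0r.
have eform : adj_form L = adj_form L' + 2%:R * \sum_(v in L') (e u v)%:R * (w u * w v).
  rewrite /adj_form (sum_setD1 _ uL) (sum_setD1 _ uL) eirr mul0r add0r.
  have -> : \sum_(v in L') \sum_(v0 in L) (e v v0)%:R * (w v * w v0)
     = \sum_(v in L') (e u v)%:R * (w u * w v) + \sum_(v in L') \sum_(v0 in L') (e v v0)%:R * (w v * w v0).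
    rewrite -big_split; apply: eq_bigr => v _ /=; rewrite (sum_setD1 _ uL) esym.
    by rewrite [w v * w u]mulrC.
  by rewrite addrA -mulr2n mulr_natl addrC.
have hcross : 2%:R * \sum_(v in L') (e u v)%:R * (w u * w v)
   <= m%:R * al * w u ^+ 2 + al^-1 * \sum_(v in L') (e u v)%:R * w v ^+ 2.
  apply: le_trans (_ : degree_in L' u * al * w u ^+ 2 + al^-1 * \sum_(v in L') (e u v)%:R * w v ^+ 2 <= _).
    rewrite /degree_in !mulr_suml !mulr_sumr -big_split; apply: ler_sum => v _ /=.
    case: (e u v); rewrite /= ?mul0r ?mulr0 ?addr0 // !mul1r.
    have : 0 <= al * (w u - al^-1 * w v) ^+ 2 by rewrite mulr_ge0 ?sqr_ge0 // ltW.
    rewrite sqrrB exprMn; have al1 : al * al^-1 = 1 by rewrite divff ?gt_eqF.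
    have -> : al * (w u ^+ 2 - w u * (al^-1 * w v) *+ 2 + al^-1 ^+ 2 * w v ^+ 2)
      = al * w u ^+ 2 - (al * al^-1) * (2%:R * (w u * w v)) + (al * al^-1) * al^-1 * w v ^+ 2 by ring.
    by rewrite al1 !mul1r; lra.
  rewrite lerD2r ler_wpM2r ?sqr_ge0 // ler_wpM2r ?(ltW al0) // -d0 ltW //.
(* Deleting [u] lowers the degree of each remaining neighbour [v] by one, which releases exactly the
   [w v ^ 2] spent in [hcross]. *)
have hdeg2 : \sum_(v in L) degree_in L v * w v ^+ 2
   = degree_in L u * w u ^+ 2 + \sum_(v in L') (e u v)%:R * w v ^+ 2
     + \sum_(v in L') degree_in L' v * w v ^+ 2.
  rewrite (sum_setD1 _ uL) -addrA -big_split; congr (_ + _); apply: eq_bigr => v _ /=.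
  by rewrite {1}/degree_in (sum_setD1 _ uL) esym mulrDl.
have hdu : 0 <= al^-1 * (degree_in L u * w u ^+ 2).
  have dg : 0 <= degree_in L u by apply: sumr_ge0.
  by rewrite mulr_ge0 ?invr_ge0 ?(ltW al0) // mulr_ge0 ?sqr_ge0.
rewrite eform hdeg2 (sum_setD1 _ uL) !mulrDr.
by lra.
Qed.

(** The Frobenius norm bounds the spectral norm, and its square is the number of ordered adjacent
    pairs in [S]. AM-GM with parameter [b / W] replaces Cauchy-Schwarz. *)
Lemma adj_form_le (S : {set T}) (b : R) : (forall u, 0 <= w u) -> 0 < b ->
  \sum_(u in S) degree_in S u <= b ^+ 2 -> adj_form S <= b * \sum_(u in S) w u ^+ 2.
Proof.
move=> w0 b0 hb; set W := \sum_(u in S) _.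
have W0 : 0 <= W by apply: sumr_ge0 => u _; apply: sqr_ge0.
have [Wz|Wp] := eqVneq W 0.
  have z u : u \in S -> w u = 0.
    move=> uS; apply/eqP; rewrite -sqrf_eq0; apply/eqP.
  exact: (psumr_eq0P (fun u _ => sqr_ge0 (w u)) Wz).
  rewrite Wz mulr0 /adj_form big1 // => u uS; rewrite big1 // => v vS.
  by rewrite z // mul0r mulr0.
have {}Wp : 0 < W by rewrite lt_def Wp.
have bW : 0 < b / W by rewrite divr_gt0.
have h u v : (e u v)%:R * (w u * w v) <= (2%:R * b)^-1 * W * (e u v)%:R
    + b / W / 2%:R * (w u ^+ 2 * w v ^+ 2).
  case: (e u v); rewrite /= ?mul0r ?mulr0 ?add0r.
    rewrite mul1r mulr1.
    have : 0 <= (b / W) * (w u * w v - W / b) ^+ 2 by rewrite mulr_ge0 ?sqr_ge0 // ltW.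
    have -> : (b / W) * (w u * w v - W / b) ^+ 2
       = 2%:R * (b / W / 2%:R * (w u ^+ 2 * w v ^+ 2) + (2%:R * b)^-1 * W - w u * w v).
      by field; rewrite !gt_eqF.
    by lra.
  by rewrite !mulr_ge0 ?sqr_ge0 ?invr_ge0 // ltW.
apply: le_trans (ler_sum _ (fun u _ => ler_sum _ (fun v _ => h u v))) _.
under eq_bigr => u _ do rewrite big_split /= -!mulr_sumr.
rewrite big_split /= -!mulr_sumr -mulr_suml -/W.
have e1 : (2%:R * b)^-1 * W * b ^+ 2 + b / W / 2%:R * (W * W) = b * W.
  by field; rewrite !gt_eqF.
have b1 : 0 <= (2%:R * b)^-1 * W by rewrite mulr_ge0 // invr_ge0 mulr_ge0 // ltW.
by rewrite -e1 lerD // ler_wpM2l.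
Qed.

End Peeling.

(** * The largest eigenvalue of a symmetric matrix *)

Section Rayleigh.
Variable R : realType.
Local Open Scope ring_scope.

Definition dotv m (x y : 'rV[R]_m) : R := \sum_i x 0 i * y 0 i.

Lemma mulmx_trE m (x y : 'rV[R]_m) : (x *m y^T) 0 0 = dotv x y.
Proof. by rewrite mxE; apply: eq_bigr => i _; rewrite mxE. Qed.

Lemma dotvC m (x y : 'rV[R]_m) : dotv x y = dotv y x.
Proof. by apply: eq_bigr => i _; rewrite mulrC. Qed.

Lemma dotv_linearl m (x y z : 'rV[R]_m) t : dotv (x + t *: y) z = dotv x z + t * dotv y z.
Proof.
rewrite /dotv mulr_sumr -big_split; apply: eq_bigr => i _ /=.
by rewrite !mxE; ring.
Qed.

Lemma dotv_ge0 m (x : 'rV[R]_m) : 0 <= dotv x x.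
Proof. by apply: sumr_ge0 => i _; rewrite -expr2 sqr_ge0. Qed.

Lemma dotv_eq0 m (x : 'rV[R]_m) : dotv x x = 0 -> x = 0.
Proof.
move=> h; apply/rowP => i; rewrite mxE; apply/eqP.
have h2 (j : 'I_m) : true -> 0 <= x 0 j * x 0 j by rewrite -expr2 sqr_ge0.
have /eqP : x 0 i * x 0 i = 0 by exact: (psumr_eq0P h2 h).
by rewrite mulf_eq0 orbb.
Qed.

Lemma dotv_bound m (C : 'M[R]_m) : exists2 K : R, 0 <= K &
  forall z : 'rV[R]_m, `|dotv (z *m C) z| <= K * dotv z z.
Proof.
exists (\sum_i \sum_j `|C j i|).
  by apply: sumr_ge0 => i _; apply: sumr_ge0.
move=> z; rewrite mulr_suml; apply: le_trans (ler_norm_sum _ _ _) _.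
apply: ler_sum => i _; rewrite normrM mxE mulr_suml.
apply: le_trans (ler_wpM2r (normr_ge0 _) (ler_norm_sum _ _ _)) _.
rewrite mulr_suml; apply: ler_sum => j _; rewrite normrM mulrAC mulrC ler_wpM2l //.
have zk k : z 0 k ^+ 2 <= dotv z z.
  rewrite /dotv (bigD1 k) //= -expr2 lerDl; apply: sumr_ge0 => l _.
  by rewrite -expr2 sqr_ge0.
have := zk i; have := zk j.
rewrite -[z 0 i ^+ 2]real_normK ?num_real // -[z 0 j ^+ 2]real_normK ?num_real //.
by have := sqr_ge0 (`|z 0 i| - `|z 0 j|); rewrite sqrrB; lra.
Qed.

(* If [mu] is the supremum of the Rayleigh quotients and [B = mu - A] were invertible, the
   Cauchy-Schwarz inequality for the semidefinite form [B] would give [dotv (y B) y >= c (dotv y y)]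
   with [c > 0], and [mu - c] would still be an upper bound. *)
Lemma symmetric_top_eigenvalue m (A : 'M[R]_m.+1) : A^T = A ->
  exists (mu : R) (x : 'rV[R]_m.+1), [/\ x != 0, x *m A = mu *: x &
    forall y, dotv (y *m A) y <= mu * dotv y y].
Proof.
move=> Asym.
have [K K0 hK] := dotv_bound A.
pose E : classical_sets.set R := fun r => exists y : 'rV[R]_m.+1, y != 0 /\ r = dotv (y *m A) y / dotv y y.
have dpos (y : 'rV[R]_m.+1) : y != 0 -> 0 < dotv y y.
  move=> y0; rewrite lt_def dotv_ge0 andbT; apply: contraNneq y0 => /dotv_eq0 ->.
  exact: eqxx.
pose one : 'rV[R]_m.+1 := const_mx 1.
have ne1 : one != 0.
  by apply/eqP => /rowP/(_ 0); rewrite !mxE => /eqP; rewrite oner_eq0.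
have hsup : classical_sets.has_sup E.
  split; first by exists (dotv (one *m A) one / dotv one one); exists one.
  exists K => r [y [y0 ->]]; rewrite ler_pdivrMr ?dpos //.
  exact: le_trans (ler_norm _) (hK y).
pose mu := sup E.
have hmu y : dotv (y *m A) y <= mu * dotv y y.
  have [->|y0] := eqVneq y 0.
    by rewrite mul0mx /dotv !big1 ?mulr0 // => i _; rewrite !mxE mul0r.
  rewrite -ler_pdivrMr ?dpos //; apply: (ub_le_sup (proj2 hsup)).
  by exists y.
exists mu.
pose B := mu%:M - A.
have Bsym : B^T = B by rewrite /B linearB /= tr_scalar_mx Asym.
have dB x y : dotv (x *m B) y = mu * dotv x y - dotv (x *m A) y.
  by rewrite -!mulmx_trE mulmxBr mulmxBl mul_mx_scalar -scalemxAl !mxE.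
have [detB|detB] := eqVneq (\det B) 0.
  have /det0P[x x0 hx] : \det B == 0 by rewrite detB.
  exists x; split => //; apply/eqP; rewrite eq_sym -subr_eq0 -mul_mx_scalar -mulmxBr hx.
  exact: eqxx.
exfalso.
have Bunit : B \in unitmx by rewrite unitmxE unitfE.
have pos y : 0 <= dotv (y *m B) y by rewrite dB subr_ge0.
have [K1 K10 hK1] := dotv_bound B.
have [K2 K20 hK2] := dotv_bound (invmx B *m (invmx B)^T).
have dsym x y : dotv (x *m B) y = dotv (y *m B) x.
  rewrite -!mulmx_trE -[in LHS](trmxK (x *m B *m y^T)) mxE trmx_mul trmxK trmx_mul Bsym.
  by rewrite mulmxA.
have CS x y : dotv (x *m B) y ^+ 2 <= dotv (x *m B) x * dotv (y *m B) y.
  have hq (t : R) : 0 <= dotv (x *m B) x + 2%:R * t * dotv (x *m B) y + t ^+ 2 * dotv (y *m B) y.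
    have := pos (x + t *: y).
    rewrite mulmxDl -scalemxAl dotv_linearl dotvC dotv_linearl [dotv (y *m B) _]dotvC dotv_linearl.
    rewrite ![dotv _ (_ *m B)]dotvC (dsym y x).
    by move=> hh; apply: le_trans hh _; rewrite le_eqVlt; apply/orP; left; apply/eqP; ring.
  have [y0|y0] := eqVneq (dotv (y *m B) y) 0.
    rewrite y0 mulr0; set a := dotv (x *m B) y; set b := dotv (x *m B) x.
    have [->|a0] := eqVneq a 0; first by rewrite expr0n.
    (* The quadratic polynomial degenerates to an affine one, and this [t] would give it the value
       -1. *)
    have := hq (- (b + 1) / (2%:R * a)); rewrite y0 -/a -/b mulr0 addr0.
    have -> : 2%:R * (- (b + 1) / (2%:R * a)) * a = - (b + 1) by field; rewrite a0.
    by lra.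
  have yp : 0 < dotv (y *m B) y by rewrite lt_def y0 pos.
  have := hq (- dotv (x *m B) y / dotv (y *m B) y).
  set a := dotv (x *m B) y; set b := dotv (x *m B) x; set c := dotv (y *m B) y in y0 yp *.
  have -> : b + 2%:R * (- a / c) * a + (- a / c) ^+ 2 * c = (b * c - a ^+ 2) / c by field.
  by rewrite pmulr_lge0 ?invr_gt0 // subr_ge0.
(* For [z = y B], Cauchy-Schwarz gives [|z|^4 <= (y B y) (z B z) <= (y B y) K1 |z|^2], and
   invertibility gives [|y|^2 <= K2 |z|^2]. *)
have key y : dotv y y <= K2 * K1 * dotv (y *m B) y.
  pose z := y *m B.
  have hy : dotv y y <= K2 * dotv z z.
    have -> : dotv y y = dotv (z *m (invmx B *m (invmx B)^T)) z.
      have yz : z *m invmx B = y by rewrite /z mulmxK.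
      by rewrite -!mulmx_trE mulmxA yz -mulmxA -trmx_mul yz.
    exact: le_trans (ler_norm _) (hK2 z).
  have [z0|z0] := eqVneq (dotv z z) 0.
    by apply: le_trans hy _; rewrite z0 mulr0 !mulr_ge0.
  have zp : 0 < dotv z z by rewrite lt_def z0 dotv_ge0.
  have := CS y z; rewrite -/z => cs.
  have hz : dotv (z *m B) z <= K1 * dotv z z by apply: le_trans (ler_norm _) (hK1 z).
  have : dotv z z ^+ 2 <= dotv z y * (K1 * dotv z z).
    by apply: le_trans cs _; rewrite ler_wpM2l // pos.
  rewrite expr2 mulrA ler_pM2r // => h1.
  apply: le_trans hy _; rewrite -mulrA ler_wpM2l // [K1 * _]mulrC //.
pose M := K2 * K1 + 1.
have M0 : 0 < M by rewrite ltr_wpDl // mulr_ge0.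
have hM y : dotv y y / M <= dotv (y *m B) y.
  rewrite ler_pdivrMr // mulrC; apply: le_trans (key y) _.
  by rewrite ler_wpM2r ?pos // lerDl.
have : mu <= mu - M^-1.
  apply: ge_sup; first exact: (proj1 hsup).
  move=> r [y [y0 ->]]; rewrite ler_pdivrMr ?dpos //.
  by have := hM y; rewrite dB; lra.
by rewrite lerBrDr gerDl leNgt invr_gt0 M0.
Qed.

Lemma top_eigenvalue_on (T : finType) (S : {set T}) (B : T -> T -> R) :
  (forall u v, B u v = B v u) -> (0 < #|S|)%N ->
  exists (mu : R) (x : T -> R), [/\ forall u, u \notin S -> x u = 0,
    exists u, u \in S /\ x u <> 0,
    forall u, u \in S -> \sum_(v in S) B u v * x v = mu * x u &
    forall y : T -> R, \sum_(u in S) \sum_(v in S) B u v * (y u * y v) <= mu * \sum_(u in S) y u ^+ 2].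
Proof.
move=> Bsym S0; have [m em] : exists m, #|S| = m.+1 by case: #|S| S0 => // m _; exists m.
pose f (i : 'I_m.+1) : T := enum_val (cast_ord (esym em) i).
pose A : 'M[R]_m.+1 := \matrix_(i, j) B (f i) (f j).
have Asym : A^T = A by apply/matrixP => i j; rewrite !mxE Bsym.
have fS i : f i \in S by apply: enum_valP.
have finj : injective f by move=> i j /enum_val_inj/cast_ord_inj.
have fsur u : u \in S -> exists i, u = f i.
  move=> uS; exists (cast_ord em (enum_rank_in uS u)).
  by rewrite /f cast_ordK enum_rankK_in.
have sumE (F : T -> R) : \sum_(u in S) F u = \sum_i F (f i).
  rewrite big_enum_val (reindex (cast_ord (esym em))) //=.
  by exists (cast_ord em) => i _; rewrite ?cast_ordK ?cast_ordKV.
have [mu [x [x0 hx hmax]]] := symmetric_top_eigenvalue Asym.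
pose X u : R := \sum_i (u == f i)%:R * x 0 i.
have Xf i : X (f i) = x 0 i.
  rewrite /X (bigD1 i) //= eqxx mul1r big1 ?addr0 // => j ji.
  by rewrite (inj_eq finj) eq_sym (negPf ji) mul0r.
exists mu, X; split.
- move=> u uS; rewrite /X big1 // => i _; case: eqP => [e|]; last by rewrite mul0r.
  by move: uS; rewrite e fS.
- have [i xi] : exists i, x 0 i != 0.
    apply/existsP; apply: contraNT x0; rewrite negb_exists => /forallP hall.
    by apply/eqP/rowP => i; rewrite mxE; apply/eqP; have := hall i; rewrite negbK.
  by exists (f i); rewrite fS Xf; split => //; apply/eqP.
- move=> u /fsur[i ->]; rewrite sumE Xf.
  have /rowP/(_ i) := hx; rewrite !mxE => <-; apply: eq_bigr => j _.
  by rewrite mxE Xf Bsym mulrC.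
move=> y; pose yy : 'rV[R]_m.+1 := \row_i y (f i).
have e1 : dotv (yy *m A) yy = \sum_(u in S) \sum_(v in S) B u v * (y u * y v).
  rewrite sumE; apply: eq_bigr => i _; rewrite sumE mxE mulr_suml.
  by apply: eq_bigr => j _; rewrite !mxE (Bsym (f j)); ring.
have e2 : dotv yy yy = \sum_(u in S) y u ^+ 2.
  by rewrite sumE; apply: eq_bigr => i _; rewrite !mxE expr2.
by have := hmax yy; rewrite e1 e2.
Qed.

End Rayleigh.

(** * Structure of new eigenvectors *)

Section Structure.
Variable R : realType.
Local Open Scope ring_scope.

Lemma card_exists_le (I T : finType) (E : I -> {set T}) (b : R) :
  (forall i, #|E i|%:R <= b) -> #|[set t | [exists i, t \in E i]]|%:R <= #|I|%:R * b.
Proof.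
move=> hE.
have -> : [set t | [exists i, t \in E i]] = \bigcup_i E i.
  apply/setP => t; rewrite inE; apply/existsP/bigcupP => [[i ti]|[i _ ti]]; by exists i.
have h1 : #|\bigcup_i E i|%:R <= \sum_i #|E i|%:R :> R.
  rewrite -natr_sum ler_nat; elim/big_rec2: _ => [|i m B _ hB]; first by rewrite cards0.
  by rewrite cardsU; apply: leq_trans (leq_subr _ _) _; rewrite leq_add2l.
apply: le_trans h1 _; apply: le_trans (ler_sum _ (fun i _ => hE i)) _.
by rewrite sumr_const mulr_natl.
Qed.

(** Total failure probability: a fixed number [N1] of group events decaying exponentially, plus the
    dense subset event. One spare power of [n] absorbs the constants. *)
Lemma exp_decay_beats_power (N1 eps : R) (Q : nat) : 0 <= N1 -> 0 < eps ->
  exists N, forall n, (N <= n)%N ->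
    N1 * expR (- (eps * n%:R)) + (n%:R ^+ Q.+1)^-1 <= (n%:R ^+ Q)^-1.
Proof.
move=> N10 eps0.
pose K := N1 * Q.+1`!%:R / eps ^+ Q.+1.
have K0 : 0 <= K by rewrite !mulr_ge0 ?invr_ge0 ?exprn_ge0 // ltW.
exists (Num.bound (K + 1)).+1 => n hn.
have hKn : K + 1 <= n%:R.
  apply: le_trans (ltW (archi_boundP _)) _; first by rewrite addr_ge0.
  by rewrite ler_nat; apply: leq_trans hn.
have np : 0 < n%:R :> R by lra.
have h1 : N1 * expR (- (eps * n%:R)) <= K / n%:R ^+ Q.+1.
  rewrite expRN /K -!mulrA ler_wpM2l // -invfM -exprMn.
  have xp : 0 < (eps * n%:R) ^+ Q.+1 by rewrite exprn_gt0 // mulr_gt0.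
  have fp : 0 < Q.+1`!%:R :> R by rewrite ltr0n fact_gt0.
  rewrite -[leRHS]invrK lef_pV2 ?posrE ?expR_gt0 ?invr_gt0 ?divr_gt0 //.
  rewrite invf_div; have x0 : 0 <= eps * n%:R by rewrite mulr_ge0 // ltW.
  by have := expR_ge1Dxn Q x0; lra.
apply: le_trans (_ : (K + 1) / n%:R ^+ Q.+1 <= _).
  by rewrite mulrDl mul1r lerD2r.
rewrite ler_pdivrMr ?exprn_gt0 // exprS mulrCA mulVf ?mulr1 // expf_neq0 // gt_eqF //.
Qed.

(** For a core with [a] vertices, degree sum [dg] and [b = Q + 1]: minimum degree 32 against the
    sparsity bound leaves [12 a <= 10 b], hence [dg <= 80/3 b]. *)
Lemma core_arith (a dg b : R) : 32%:R * a <= dg -> dg <= 20%:R * a + 10%:R * b -> 0 <= b ->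
  6%:R * a <= 5%:R * b /\ dg <= 27%:R * b.
Proof. by move=> *; split; lra. Qed.

(** Here [27697 = 2830 * 9 + 384 * 5 + 1 + 34 * 9]. *)
Lemma total_arith (q m N W W1 X F : R) : 1 <= q -> 0 <= N -> W <= 9%:R * N -> W1 <= 5%:R * N ->
  m <= N -> X <= F + (33%:R * q + 1) * W ->
  q * (2830%:R * W + 384%:R * W1 + m) + X <= 27697%:R * q * N + F.
Proof.
move=> q1 N0 hW hW1 hm hX.
have q0 : 0 <= q by lra.
have := ler_wpM2l q0 hW; have := ler_wpM2l q0 hW1; have := ler_wpM2l q0 hm.
have : N <= q * N by rewrite ler_peMl.
by lra.
Qed.

Variables (h : nat) (H : rel 'I_h).
Hypotheses (Hsym : symmetric H) (Hirr : irreflexive H).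

(** For fixed [u], [base_mean] is constant on every fibre, so a balanced vector annihilates it. *)
Lemma fibre_balanced_form n (s : lift_space h n) (x : 'I_h * 'I_n -> R) :
  (forall i, \sum_j x (i, j) = 0) ->
  \sum_u \sum_v centered_adj R H s u v * (x u * x v)
   = \sum_u \sum_v (lift_adj H s u v)%:R * (x u * x v).
Proof.
move=> hbal; apply: eq_bigr => u _.
rewrite /centered_adj; under eq_bigr => v _ do rewrite mulrBl.
rewrite sumrB (sum_fibres (fun v => base_mean R H u v * (x u * x v))).
rewrite [X in _ - X]big1 ?subr0 // => i _; rewrite /base_mean /=.
by rewrite -mulr_sumr -mulr_sumr hbal !mulr0.
Qed.

(** Peeling with [m = 32] and weight [q] costs [32 q + maxdeg H / q <= 33 q] times the mass; the
    mean part costs at most the mass because [L] has at most [n] vertices. *)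
Lemma high_level_form n (s : lift_space h n) (w : 'I_h * 'I_n -> R) (q : R) (L : {set 'I_h * 'I_n}) :
  (0 < n)%N -> 0 < q -> (maxdeg H)%:R <= q ^+ 2 -> (#|L| <= n)%N -> (forall u, 0 <= w u) ->
  exists S : {set 'I_h * 'I_n}, [/\ S \subset L,
     forall u, u \in S -> 32%:R <= degree_in R (lift_adj H s) S u &
     \sum_(u in L) \sum_(v in L) ((lift_adj H s u v)%:R + base_mean R H u v) * (w u * w v)
      <= adj_form (lift_adj H s) w S + (33%:R * q + 1) * \sum_u w u ^+ 2].
Proof.
move=> n0 q0 hq hL w0.
have np : 0 < n%:R :> R by rewrite ltr0n.
have esym : symmetric (lift_adj H s) by move=> u v; apply: lift_adjC.
have eirr : irreflexive (lift_adj H s) by move=> u; rewrite /lift_adj Hirr.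
have [S [SL hS hform]] := peel w esym eirr 32 L q0.
exists S; split => //.
set W := \sum_u w u ^+ 2.
have WL : \sum_(u in L) w u ^+ 2 <= W.
  rewrite /W [leRHS](bigID [in L]) /= lerDl; apply: sumr_ge0 => u _; apply: sqr_ge0.
have WL0 : 0 <= \sum_(u in L) w u ^+ 2 by apply: sumr_ge0 => u _; apply: sqr_ge0.
have hdeg : \sum_(u in L) degree_in R (lift_adj H s) L u * w u ^+ 2 <= q ^+ 2 * W.
  apply: le_trans (_ : q ^+ 2 * \sum_(u in L) w u ^+ 2 <= _); last first.
    by rewrite ler_wpM2l // sqr_ge0.
  rewrite mulr_sumr; apply: ler_sum => u _; rewrite ler_wpM2r ?sqr_ge0 //.
  apply: le_trans hq; apply: le_trans (lift_adj_degree R H s u).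
  rewrite /degree_in [leRHS](bigID [in L]) /= lerDl; exact: sumr_ge0.
have hmean : \sum_(u in L) \sum_(v in L) base_mean R H u v * (w u * w v) <= W.
  apply: le_trans (_ : \sum_(u in L) \sum_(v in L) (n%:R^-1 * (w u ^+ 2 + w v ^+ 2) / 2%:R) <= _).
    apply: ler_sum => u _; apply: ler_sum => v _; rewrite /base_mean.
    have hw : w u * w v <= (w u ^+ 2 + w v ^+ 2) / 2%:R.
      by have := sqr_ge0 (w u - w v); rewrite sqrrB; lra.
    rewrite -mulrA; apply: ler_pM => //; rewrite ?mulr_ge0 ?invr_ge0 //.
    by case: (H _ _); rewrite ?mul1r ?mul0r ?invr_ge0.
  have e1 : \sum_(u in L) \sum_(v in L) (n%:R^-1 * (w u ^+ 2 + w v ^+ 2) / 2%:R)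
     = #|L|%:R / n%:R * \sum_(u in L) w u ^+ 2.
    have e0 : \sum_(u in L) \sum_(v in L) (w u ^+ 2 + w v ^+ 2)
       = 2%:R * #|L|%:R * \sum_(u in L) w u ^+ 2.
      under eq_bigr => u _ do rewrite big_split /= sumr_const.
      rewrite big_split /= sumr_const sumrMnl.
      by set X := \sum_(_ in L) _; rewrite -[X *+ _]mulr_natl; ring.
    have -> : \sum_(u in L) \sum_(v in L) (n%:R^-1 * (w u ^+ 2 + w v ^+ 2) / 2%:R)
       = n%:R^-1 / 2%:R * \sum_(u in L) \sum_(v in L) (w u ^+ 2 + w v ^+ 2).
      rewrite mulr_sumr; apply: eq_bigr => u _; rewrite mulr_sumr; apply: eq_bigr => v _.
      by rewrite mulrAC.
    by rewrite e0; field; rewrite gt_eqF.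
  rewrite e1; apply: le_trans WL; rewrite ler_piMl // ler_pdivrMr // mul1r ler_nat //.
have split_sum : \sum_(u in L) \sum_(v in L) ((lift_adj H s u v)%:R + base_mean R H u v) * (w u * w v)
   = adj_form (lift_adj H s) w L + \sum_(u in L) \sum_(v in L) base_mean R H u v * (w u * w v).
  rewrite -big_split; apply: eq_bigr => u _ /=; rewrite -big_split; apply: eq_bigr => v _ /=.
  by rewrite mulrDl.
rewrite split_sum.
have h1 : q^-1 * \sum_(u in L) degree_in R (lift_adj H s) L u * w u ^+ 2 <= q * W.
  have qi : 0 <= q^-1 by rewrite invr_ge0 ltW.
  apply: le_trans (ler_wpM2l qi hdeg) _.
  by rewrite expr2 !mulrA mulVf ?gt_eqF // mul1r.
have := ler_wpM2l (ltW q0) WL; lra.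
Qed.

Definition new_eigenvector n (s : lift_space h n) (x : 'I_h * 'I_n -> R) (l : R) :=
  [/\ exists u, x u <> 0, forall i, \sum_j x (i, j) = 0 &
    forall u, \sum_v (lift_adj H s u v)%:R * x v = l * x u].

Lemma new_eigenvector_scale n (s : lift_space h n) x l :
  new_eigenvector s x l -> exists2 y, new_eigenvector s y l & \sum_u y u ^+ 2 = (h * n)%:R.
Proof.
case=> -[u0 xu0] hbal heig.
have hn0 : 0 < (h * n)%:R :> R.
  by rewrite ltr0n -[h]card_ord -[n in (_ * n)%N]card_ord -card_prod; apply/card_gt0P; exists u0.
set X := \sum_u x u ^+ 2.
have X0 : 0 < X.
  rewrite /X (bigD1 u0) //= ltr_pwDl //; last by apply: sumr_ge0 => u _; apply: sqr_ge0.
  by rewrite lt_def sqr_ge0 andbT sqrf_eq0; apply/eqP.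
pose t := Num.sqrt ((h * n)%:R / X).
have t0 : 0 < t by rewrite sqrtr_gt0 divr_gt0.
exists (fun u => t * x u).
  split; first by exists u0 => /eqP; rewrite mulf_eq0 gt_eqF //= => /eqP.
    by move=> i; rewrite -mulr_sumr hbal mulr0.
  by move=> u; rewrite mulrCA -heig mulr_sumr; apply: eq_bigr => v _; rewrite mulrCA.
under eq_bigr => u _ do rewrite exprMn.
rewrite -mulr_sumr sqr_sqrtr ?divr_ge0 ?(ltW X0) // divfK // gt_eqF //.
Qed.

(** Common source of both bounds: outside a small bad set, a new eigenvalue is [O(2 ^ D)] up to the
    form on a core that has few vertices and few edges. *)
Lemma spectral_structure (D Q : nat) : (maxdeg H)%:R <= (2%:R ^+ D) ^+ 2 :> R ->
  exists N, forall n, (N <= n)%N -> exists Bad : {set lift_space h n},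
    #|Bad|%:R <= #|lift_space h n|%:R / n%:R ^+ Q :> R /\
    forall s, s \notin Bad -> forall x l, new_eigenvector s x l ->
    exists (S : {set 'I_h * 'I_n}) (w : 'I_h * 'I_n -> R),
     [/\ (6 * #|S| <= 5 * Q + 5)%N,
         \sum_(u in S) degree_in R (lift_adj H s) S u <= 27%:R * Q.+1%:R,
         forall u, 0 <= w u, \sum_u w u ^+ 2 <= 9%:R * (h * n)%:R &
         `|l| * (h * n)%:R <= 27697%:R * 2%:R ^+ D * (h * n)%:R + adj_form (lift_adj H s) w S].
Proof.
move=> hq; pose q : R := 2%:R ^+ D.
have q0 : 0 < q by rewrite exprn_gt0.
have q1 : 1 <= q by rewrite exprn_ege1 // ler1n.
have [eps eps0 hsparse] := card_dense_subset_event R Hsym Hirr Q.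
pose e1 := Num.min eps 1.
have e10 : 0 < e1 by rewrite lt_min eps0 ltr01.
(* The second summand makes the set of levels at least [A] smaller than [e1 * n]. With [A > h], a
   vertex of such a level has positive height, so its [x u ^ 2] is comparable to [4 ^ level]. *)
pose A := (h.+1 + Num.bound (4%:R * h%:R / e1))%N.
have hAh : (h < A)%N by rewrite /A addSn ltnS leq_addr.
have hA : 4%:R * h%:R / e1 <= 4%:R ^+ A.
  apply: le_trans (ltW (archi_boundP _)) _; first by rewrite divr_ge0 ?mulr_ge0 // ltW.
  rewrite -natrX ler_nat; apply: leq_trans (ltnW (ltn_expl A (isT : 1 < 4)%N)).
  by rewrite /A leq_addl.
have A4 : 0 < 4%:R ^+ A :> R by rewrite exprn_gt0.
pose e2 : R := (43%:R * 4%:R ^+ A)^-1.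
have e20 : 0 < e2 by rewrite invr_gt0 mulr_gt0.
(* The size of [I] does not depend on [n]: heights and signs were already summed inside each group
   event. *)
pose I := ({ffun 'I_h -> 'I_h.+1} * ('I_A * 'I_(A + D)))%type.
have [N hN] := exp_decay_beats_power Q (ler0n R #|{: I}|) e20.
exists N.+1 => n hn.
have n0 : (0 < n)%N by apply: leq_trans hn.
have np : 0 < n%:R :> R by rewrite ltr0n.
pose Ev (i : I) := [set s : lift_space h n | [exists k : {ffun 'I_h * 'I_n -> 'I_n.+1},
  exists sg : {ffun 'I_h * 'I_n -> bool}, exists tau : {ffun 'I_h * 'I_n -> bool},
      let kn := fun u => k u : nat in
      let c := group_coef D (fun j => i.1 j : nat) kn (fun u => (-1) ^+ sg u) (fun u => (-1) ^+ tau u) i.2.1 i.2.2 in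
      code_length R (fun j => i.1 j : nat) kn i.2.1 i.2.2 + mgf_cost H c + e2 * n%:R < deviation H c s]].
pose Bad1 := [set s : lift_space h n | [exists i, s \in Ev i]].
pose Bad2 := [set s : lift_space h n | [exists S : {set 'I_h * 'I_n}, (#|S|%:R <= eps * n%:R) &&
      ((20 * #|S| + 10 * Q + 10)%:R < \sum_(u in S) \sum_(v in S) (lift_adj H s u v)%:R :> R)]].
exists (Bad1 :|: Bad2); split.
  have c1 : #|Bad1|%:R <= #|{: I}|%:R * (#|lift_space h n|%:R * expR (- (e2 * n%:R))) :> R.
    by apply: card_exists_le => i; apply: card_group_event.
  have c2 : #|Bad2|%:R <= #|lift_space h n|%:R / n%:R ^+ Q.+1 :> R by apply: hsparse.
  have c3 : #|Bad1 :|: Bad2|%:R <= #|Bad1|%:R + #|Bad2|%:R :> R.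
    by rewrite -natrD ler_nat cardsU leq_subr.
  have := ler_wpM2l (ler0n R #|lift_space h n|) (hN n (ltnW hn)).
  by rewrite mulrDr mulrCA; lra.
move=> s; rewrite in_setU negb_or => /andP[s1 s2] x0 l /new_eigenvector_scale[x [[u0 _] hbal heig] sx].
have [d [k [[dh kn xw kx] fm hW hd]]] := exists_levels sx.
pose w u : R := 2%:R ^+ level d k u.
have w0 u : 0 <= w u by rewrite exprn_ge0.
have w2 u : w u ^+ 2 = 4%:R ^+ level d k u.
  by rewrite /w -exprM mulnC exprM; congr (_ ^+ _); ring.
have sw : \sum_u w u ^+ 2 <= 9%:R * (h * n)%:R by under eq_bigr => u _ do rewrite w2.
have Csym u v : centered_adj R H s u v = centered_adj R H s v u by apply: centered_adjC.
have [sg [tau hsg]] := exists_signs Csym xw.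
have el : `|l| * (h * n)%:R = `|\sum_u \sum_v centered_adj R H s u v * (x u * x v)|.
  rewrite fibre_balanced_form // -sx -[X in _ * X]ger0_norm; last first.
    by apply: sumr_ge0 => u _; apply: sqr_ge0.
  rewrite -normrM mulr_sumr; congr (`|_|); apply: eq_bigr => u _.
  rewrite expr2 mulrA -heig mulr_suml; apply: eq_bigr => v _.
  by rewrite -mulrA [x v * _]mulrC.
have sgn1 (f : {ffun 'I_h * 'I_n -> bool}) u : `|(-1) ^+ f u| <= 1 :> R by rewrite normrX normrN1 expr1n.
have e2n : 0 <= e2 * n%:R by rewrite mulr_ge0 // ltW.
pose c a r := group_coef D d k (fun u => (-1) ^+ sg u) (fun u => (-1) ^+ tau u) a r : _ -> _ -> R.
have hdev a r : (a < A)%N -> (r < A + D)%N ->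
    deviation H (c a r) s <= code_length R d k a r + mgf_cost H (c a r) + e2 * n%:R.
  move=> aA rA; rewrite leNgt; apply: contra s1 => hdev.
  rewrite inE; apply/existsP.
  exists ([ffun i => inord (d i)], (Ordinal aA, Ordinal rA)); rewrite inE.
  apply/existsP; exists [ffun u => inord (k u)]; apply/existsP; exists sg; apply/existsP; exists tau.
  have -> : (fun j : 'I_h => ([ffun i => inord (d i)] : {ffun 'I_h -> 'I_h.+1}) j : nat) = d.
    by apply/funext => i; rewrite ffunE inordK // ltnS.
  have -> : (fun u => ([ffun u => inord (k u)] : {ffun 'I_h * 'I_n -> 'I_n.+1}) u : nat) = k.
    by apply/funext => u; rewrite ffunE inordK // ltnS.
  exact: hdev.
have := quadratic_form_bound Hsym Hirr n0 hq fm (sgn1 sg) (sgn1 tau) e2n hdev.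
pose L := [set u | (A <= level d k u)%N].
have kpos u : u \in L -> (0 < k u)%N.
  rewrite inE /level lt0n; apply: contraTneq => ->; rewrite addn0 -ltnNge.
  by apply: leq_ltn_trans (dh _) hAh.
have cL : #|L|%:R * 4%:R ^+ A <= 4%:R * (h * n)%:R :> R.
  rewrite mulr_natl -sumr_const -sx mulr_sumr [leRHS](bigID [in L]) /= -[leLHS]addr0 lerD //.
    apply: ler_sum => u uL; apply: le_trans (kx u (kpos u uL)).
    by rewrite ler_weXn2l ?ler1n //; move: uL; rewrite inE.
  by apply: sumr_ge0 => u _; rewrite mulr_ge0 ?sqr_ge0.
have cL2 : #|L|%:R <= e1 * n%:R :> R.
  rewrite -(ler_pM2r A4); apply: le_trans cL _.
  move: hA; rewrite ler_pdivrMr // natrM => hA'.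
  by have := ler_wpM2r (ltW np) hA'; lra.
have cLn : (#|L| <= n)%N.
  rewrite -(ler_nat R); apply: le_trans cL2 _; rewrite ler_piMl //.
  by rewrite ge_min lexx orbT.
have [S [SL hS hform]] := high_level_form s n0 q0 hq cLn w0.
have eL : \sum_u \sum_v (if (A <= level d k u)%N && (A <= level d k v)%N then
          ((lift_adj H s u v)%:R + base_mean R H u v) * (2%:R ^+ level d k u * 2%:R ^+ level d k v) else 0)
   = \sum_(u in L) \sum_(v in L) ((lift_adj H s u v)%:R + base_mean R H u v) * (w u * w v).
  rewrite [RHS]big_mkcond; apply: eq_bigr => u _; rewrite inE.
  case: (A <= level d k u)%N => /=; last by rewrite big1.
  by rewrite [RHS]big_mkcond; apply: eq_bigr => v _; rewrite inE.
rewrite eL => hmain.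
have hS2 : \sum_(u in S) degree_in R (lift_adj H s) S u <= (20 * #|S| + 10 * Q + 10)%:R.
  rewrite leNgt; apply: contra s2 => hgt; rewrite inE; apply/existsP; exists S; rewrite hgt andbT.
  apply: le_trans (_ : #|L|%:R <= _); first by rewrite ler_nat subset_leq_card.
  by apply: le_trans cL2 _; rewrite ler_pM2r // ge_min lexx.
have hS3 : 32%:R * #|S|%:R <= \sum_(u in S) degree_in R (lift_adj H s) S u.
  by rewrite mulr_natr -sumr_const; apply: ler_sum.
have eQ : (20 * #|S| + 10 * Q + 10)%:R = 20%:R * #|S|%:R + 10%:R * Q.+1%:R :> R.
  by rewrite -[Q.+1]addn1 !(natrD, natrM); ring.
rewrite eQ in hS2.
have [b1 b2] := core_arith hS3 hS2 (ler0n R Q.+1).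
exists S, w; split => //.
  by rewrite -(ler_nat R) -mulnSr !natrM.
rewrite el; apply: le_trans hsg _; apply: le_trans hmain _.
have e2E : 43%:R * 4%:R ^+ A * (e2 * n%:R) = n%:R.
  by rewrite mulrA divff ?mul1r // gt_eqF // mulr_gt0.
have nhn : n%:R <= (h * n)%:R :> R.
  by rewrite ler_nat leq_pmull // (leq_ltn_trans (leq0n _) (ltn_ord u0.1)).
have sw2 : \sum_u w u ^+ 2 = \sum_u 4%:R ^+ level d k u by apply: eq_bigr => u _.
rewrite sw2 in hform; rewrite e2E.
exact: total_arith q1 (ler0n R (h * n)) hW hd nhn hform.
Qed.

End Structure.

(** * Bounds for new eigenvalues *)

Section NewEigenvalueBounds.
Variable R : realType.
Local Open Scope ring_scope.
Variables (h : nat) (H : rel 'I_h).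
Hypotheses (Hsym : symmetric H) (Hirr : irreflexive H) (Hdeg : (2 <= maxdeg H)%N).
Local Notation Delta := (maxdeg H).
Local Notation r := (Num.sqrt Delta%:R : R).

Lemma sqrt_maxdeg_sqr : r ^+ 2 = Delta%:R.
Proof. by rewrite sqr_sqrtr. Qed.

Lemma sqrt_maxdeg_gt0 : 0 < r.
Proof. by rewrite sqrtr_gt0 ltr0n; apply: leq_trans Hdeg. Qed.

Lemma exists_dyadic_sqrt : exists D, Delta%:R <= (2%:R ^+ D) ^+ 2 :> R /\ 2%:R ^+ D <= 2%:R * r.
Proof.
have e4 m : (2%:R ^+ m) ^+ 2 = 4%:R ^+ m :> R.
  by rewrite -exprM mulnC exprM; congr (_ ^+ _); ring.
exists (up_log 4 Delta); split.
  by rewrite e4 -natrX ler_nat up_logP.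
rewrite -(@ler_pXn2r _ 2) ?nnegrE ?exprn_ge0 ?mulr_ge0 ?(ltW sqrt_maxdeg_gt0) //.
rewrite e4 exprMn sqrt_maxdeg_sqr.
have : (0 < up_log 4 Delta)%N by rewrite up_log_gt0.
have := up_log_gtn (isT : 1 < 4)%N Hdeg.
case: up_log => // m /= hm _; rewrite exprS -natrX expr2.
have : (4 ^ m)%:R <= Delta%:R :> R by rewrite ler_nat ltnW.
by lra.
Qed.

Lemma exists_max_degree : exists i : 'I_h, \sum_j (H i j)%:R = Delta%:R :> R.
Proof.
have h0 : (0 < #|'I_h|)%N.
  rewrite lt0n; apply: contraTneq Hdeg => h0; rewrite -ltnNge /maxdeg big1 // => i _.
  by have := fintype0 i h0.
have [i hi] := @bigop.eq_bigmax _ (fun i => #|[set j | H i j]|) h0; exists i.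
rewrite -natr_sum /maxdeg hi -sum1_card [in RHS]big_mkcond /=.
by congr (_%:R); apply: eq_bigr => j _; rewrite inE; case: (H i j).
Qed.

Lemma maxdeg_lt : (Delta < h)%N.
Proof.
rewrite /maxdeg; have [i _] := exists_max_degree.
have hp : (0 < h)%N by apply: leq_ltn_trans (ltn_ord i).
apply: leq_ltn_trans (_ : _ <= h.-1)%N _; last by rewrite ltn_predL.
apply/bigmax_leqP => j _.
rewrite -ltnS prednK // -[X in (_ < X)%N]card_ord -cardsT proper_card //.
by apply/properP; split; [exact: subsetT | exists j; rewrite // inE Hirr].
Qed.

Lemma new_eigenvector_size_gt0 n (s : lift_space h n) (x : 'I_h * 'I_n -> R) l :
  new_eigenvector H s x l -> 0 < (h * n)%:R :> R.
Proof.
case=> -[u _] _ _; rewrite ltr0n muln_gt0.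
by rewrite (leq_ltn_trans (leq0n _) (ltn_ord u.1)) (leq_ltn_trans (leq0n _) (ltn_ord u.2)).
Qed.

Lemma sum_subset_sqr (T : finType) (S : {set T}) (w : T -> R) :
  \sum_(u in S) w u ^+ 2 <= \sum_u w u ^+ 2.
Proof. by rewrite [leRHS](bigID [in S]) /= lerDl; apply: sumr_ge0 => u _; apply: sqr_ge0. Qed.

(** With [Q = 2 Delta] the core has degree sum at most [27 (2 Delta + 1) <= (9 r)^2], so its form is
    at most [9 r] times the mass. In total [2 * 27697 + 81 <= 236^2]. *)
Lemma new_eigenvalue_bound : exists N, forall n, (N <= n)%N ->
  exists Bad : {set lift_space h n},
    #|Bad|%:R <= #|lift_space h n|%:R / n%:R ^+ (2 * Delta) :> R /\
    forall s, s \notin Bad -> forall x l, new_eigenvector H s x l ->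
      `|l| <= 236%:R * 236%:R * r.
Proof.
have [D [hq qr]] := exists_dyadic_sqrt.
have [N hN] := spectral_structure Hsym Hirr (2 * Delta) hq.
exists N => n /hN[Bad [cB hB]]; exists Bad; split => // s /hB{}hB x l hx.
have [S [w [_ hS w0 hw hl]]] := hB x l hx.
have hn0 := new_eigenvector_size_gt0 hx.
have r0 := sqrt_maxdeg_gt0.
have D2 : 2%:R <= Delta%:R :> R by rewrite ler_nat.
have hS2 : \sum_(u in S) degree_in R (lift_adj H s) S u <= (9%:R * r) ^+ 2.
  apply: le_trans hS _; rewrite exprMn sqrt_maxdeg_sqr -[(2 * Delta).+1]addn1 natrD natrM; lra.
have r9 : 0 < 9%:R * r by rewrite mulr_gt0.
have hF := adj_form_le w0 r9 hS2.
have hW : \sum_(u in S) w u ^+ 2 <= 9%:R * (h * n)%:R by apply: le_trans (sum_subset_sqr _ _) hw.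
have h1 := ler_wpM2l (ltW r9) hW; have h2 := ler_wpM2r (ltW hn0) qr.
have h3 : 0 <= r * (h * n)%:R by rewrite mulr_ge0 // ltW.
rewrite -(ler_pM2r hn0); move: hl hF h1 h2 h3; clear; lra.
Qed.

(** The star of a vertex of maximal degree, tested on the vector equal to [r] at the centre and 1 at
    the leaves: the form is at least [2 Delta r] and the squared norm is [2 Delta]. Edges between
    leaves only help. *)
Lemma star_top_eigenvalue n (s : lift_space h n) : (0 < n)%N ->
  exists S : {set 'I_h * 'I_n}, [/\ (0 < #|S|)%N, (#|S| <= h * Delta)%N &
    forall mu : R, (forall y, adj_form (lift_adj H s) y S <= mu * \sum_(u in S) y u ^+ 2) -> r <= mu].
Proof.
move=> n0; have [i hi] := exists_max_degree.
pose u0 : 'I_h * 'I_n := (i, Ordinal n0).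
pose e := lift_adj H s.
pose Nb := [set v | e u0 v].
have u0N : u0 \notin Nb by rewrite inE /e /lift_adj Hirr.
have cN : #|Nb| = Delta.
  apply/eqP; rewrite -(eqr_nat R) -hi -(lift_adj_degreeE R H s u0) -sum1_card natr_sum big_mkcond.
  by apply/eqP; apply: eq_bigr => v _; rewrite inE -/e; case: (e u0 v).
exists (u0 |: Nb); rewrite cardsU1 u0N cN add1n; split => //.
  by have := maxdeg_lt; nia.
move=> mu hmu; have r0 := sqrt_maxdeg_gt0.
pose y u := if u == u0 then r else 1.
have yN v : v \in Nb -> y v = 1.
  by move=> vN; rewrite /y; case: eqP => // e0; rewrite -e0 vN in u0N.
have sN (F : 'I_h * 'I_n -> R) : \sum_(u in u0 |: Nb) F u = F u0 + \sum_(u in Nb) F u.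
  by rewrite big_setU1.
have := hmu y; rewrite /adj_form !sN.
have -> : \sum_(u in Nb) y u ^+ 2 = Delta%:R.
  by rewrite (eq_bigr (fun=> 1)) => [|u uN]; rewrite ?yN ?expr1n // sumr_const cN.
have yu0 : y u0 = r by rewrite /y eqxx.
rewrite yu0 sqrt_maxdeg_sqr {1}/lift_adj Hirr mul0r add0r.
have -> : \sum_(v in Nb) (lift_adj H s u0 v)%:R * (r * y v) = Delta%:R * r.
  rewrite (eq_bigr (fun=> r)) => [|v vN].
    by rewrite sumr_const cN mulr_natl.
  by move: (vN); rewrite inE -/e => ->; rewrite mul1r yN // mulr1.
have h1 : Delta%:R * r <= \sum_(u in Nb) \sum_(v in u0 |: Nb) (lift_adj H s u v)%:R * (y u * y v).
  rewrite mulr_natl -[X in _ *+ X]cN -sumr_const; apply: ler_sum => u uN.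
  rewrite sN yu0 yN // mul1r (lift_adjC Hsym Hirr) -/e.
  move: (uN); rewrite inE => ->; rewrite !mul1r lerDl; apply: sumr_ge0 => v vN.
  by rewrite yN // !mulr1.
move=> h2; have Dp : 0 < Delta%:R :> R by rewrite ltr0n; apply: leq_trans Hdeg.
by rewrite -(ler_pM2l Dp); lra.
Qed.

Lemma new_eigenvalue_subgraph : exists N, forall n, (N <= n)%N ->
  exists Bad : {set lift_space h n},
    #|Bad|%:R <= #|lift_space h n|%:R / n%:R ^+ (h * Delta) :> R /\
    forall s, s \notin Bad -> exists (S : {set 'I_h * 'I_n}) (mu : R) (z : 'I_h * 'I_n -> R),
     [/\ (#|S| <= h * Delta)%N,
         [/\ forall u, u \notin S -> z u = 0, exists u, u \in S /\ z u <> 0 &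
           forall u, u \in S -> \sum_(v in S) (lift_adj H s u v)%:R * z v = mu * z u],
         forall y, adj_form (lift_adj H s) y S <= mu * \sum_(u in S) y u ^+ 2 &
         forall x l, new_eigenvector H s x l -> `|l| <= 236%:R * 236%:R * mu].
Proof.
have [D [hq qr]] := exists_dyadic_sqrt.
have [N hN] := spectral_structure Hsym Hirr (h * Delta) hq.
exists N.+1 => n hn; have n0 : (0 < n)%N by apply: leq_trans hn.
have [Bad [cB hB]] := hN n (ltnW hn); exists Bad; split => // s /hB{}hB.
pose good (S : {set 'I_h * 'I_n}) (mu : R) := exists z : 'I_h * 'I_n -> R,
     [/\ forall u, u \notin S -> z u = 0, exists u, u \in S /\ z u <> 0,
           forall u, u \in S -> \sum_(v in S) (lift_adj H s u v)%:R * z v = mu * z u &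
         forall y, adj_form (lift_adj H s) y S <= mu * \sum_(u in S) y u ^+ 2].
have /choice[mu hmu] : forall S : {set 'I_h * 'I_n}, exists m : R, (0 < #|S|)%N -> good S m.
  move=> S; have [S0|] := ltnP 0 #|S|; last by move=> _; exists 0.
  have Bsym u v : (lift_adj H s u v)%:R = (lift_adj H s v u)%:R :> R by rewrite lift_adjC.
  by have [m hm] := top_eigenvalue_on Bsym S0; exists m.
have [S1 [S10 S1h hstar]] := star_top_eigenvalue s n0.
pose P (S : {set 'I_h * 'I_n}) := (0 < #|S|)%N && (#|S| <= h * Delta)%N.
have P1 : P S1 by rewrite /P S10.
(* Taking the admissible set of largest top eigenvalue makes one [S], chosen before the new
   eigenvector, dominate both the star and the core of any new eigenvector. *)
case: (@Order.TotalTheory.arg_maxP _ _ _ S1 P mu P1) => S /andP[S0 Sh] Smax.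
have [z [z1 z2 z3 z4]] := hmu S S0.
exists S, (mu S), z; split => // x l hx.
have hn0 := new_eigenvector_size_gt0 hx.
have [S2 [w [c2 _ w0 hw hl]]] := hB x l hx.
have rmu : r <= mu S.
  apply: le_trans (Smax S1 P1); apply: hstar.
  by have [z' [_ _ _ hz]] := hmu S1 S10.
have r0 := sqrt_maxdeg_gt0.
have mu0 : 0 <= mu S by lra.
have hF : adj_form (lift_adj H s) w S2 <= mu S * (9%:R * (h * n)%:R).
  have [S20|S20] := posnP #|S2|.
    by rewrite (cards0_eq S20) /adj_form big_set0 !mulr_ge0.
  have P2 : P S2.
    have h3 : (2 < h)%N := leq_ltn_trans Hdeg maxdeg_lt.
    have arith a b : (6 <= b -> 6 * a <= 5 * b + 5 -> a <= b)%N by clear; lia.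
    by rewrite /P S20; apply: arith c2; apply: leq_mul h3 Hdeg.
  have [z' [_ _ _ hz]] := hmu S2 S20.
  apply: le_trans (hz w) _.
  have W0 : 0 <= \sum_(u in S2) w u ^+ 2 by apply: sumr_ge0 => u _; apply: sqr_ge0.
  apply: le_trans (ler_wpM2r W0 (Smax S2 P2)) _.
  by rewrite ler_wpM2l //; apply: le_trans (sum_subset_sqr _ _) hw.
rewrite -(ler_pM2r hn0).
have h1 := ler_wpM2r (ltW hn0) qr; have h2 := ler_wpM2r (ltW hn0) rmu.
have h3 : 0 <= mu S * (h * n)%:R by rewrite mulr_ge0 // ltW.
move: hl hF h1 h2 h3; clear; lra.
Qed.

End NewEigenvalueBounds.

(** * Transfer to the standard reals *)

Section StandardReals.
Local Notation R := Rdefinitions.R.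
Local Open Scope ring_scope.

Lemma adjRE (T : finType) (e : rel T) u v : adjR e u v = (e u v)%:R.
Proof. by rewrite /adjR; case: (e u v). Qed.

Lemma prob_ge (T : finType) (P : T -> Prop) (Bad : {set T}) (delta : R) : (0 < #|T|)%N ->
  (forall t, t \notin Bad -> P t) -> #|Bad|%:R <= #|T|%:R * delta -> 1 - delta <= prob P.
Proof.
move=> T0 hP hB; rewrite /prob RdivE !INRE ler_pdivlMr ?ltr0n //.
set G := [set x | _].
have : (#|T| <= #|Bad| + #|G|)%N.
  rewrite -cardsT; apply: leq_trans (_ : #|Bad :|: G| <= _)%N.
    apply/subset_leq_card/subsetP => t _; rewrite !inE.
    case: (boolP (t \in Bad)) => //= tB.
    by case: ClassicalEpsilon.excluded_middle_informative => // nP; case: nP; apply: hP.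
  by rewrite cardsU leq_subr.
by rewrite -(ler_nat R) natrD mulrBl mul1r; lra.
Qed.

Variables (h : nat) (H : rel 'I_h).
Hypotheses (Hsym : symmetric H) (Hirr : irreflexive H) (Hdeg : (2 <= maxdeg H)%N).

Lemma lift_space_gt0 n : (0 < #|lift_space h n|)%N.
Proof. by apply/card_gt0P; exists [ffun=> 1%g]. Qed.

Lemma new_eig_eigenvector n (s : lift_space h n) l : is_new_eig (lift_adj H s) l ->
  exists x : 'I_h * 'I_n -> R, new_eigenvector H s x l.
Proof.
case=> x [x0 [hbal heig]]; exists x; split => // u.
by rewrite -[RHS]heig; apply: eq_bigr => v _; rewrite adjRE.
Qed.

(** The Rayleigh quotient of an eigenvector is its eigenvalue, so a bound on all quotients bounds
    every eigenvalue. *)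
Lemma largest_eig_of_rayleigh (T : finType) (e : rel T) (S : {set T}) (mu : R) (z : T -> R) :
  (forall u, u \notin S -> z u = 0) -> (exists u, u \in S /\ z u <> 0) ->
  (forall u, u \in S -> \sum_(v in S) (e u v)%:R * z v = mu * z u) ->
  (forall y, adj_form e y S <= mu * \sum_(u in S) y u ^+ 2) -> is_largest_eig e S mu.
Proof.
move=> z0 z1 z2 hmax; split.
  exists z; split => //; split => // u uS; rewrite -[RHS]z2 //.
  by apply: eq_bigr => v _; rewrite adjRE.
move=> mu' [y [_ [[u0 [u0S yu0]] hy]]]; apply/RleP.
have p : 0 < \sum_(u in S) y u ^+ 2.
  rewrite (bigD1 u0) //= ltr_pwDl //; last by apply: sumr_ge0 => u _; apply: sqr_ge0.
  by rewrite lt_def sqr_ge0 andbT sqrf_eq0; apply/eqP.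
rewrite -(ler_pM2r p); apply: le_trans (hmax y).
rewrite le_eqVlt; apply/orP; left; apply/eqP; rewrite mulr_sumr; apply: eq_bigr => u uS.
have hu : \sum_(v in S) (e u v)%:R * y v = mu' * y u.
  by rewrite -[RHS]hy //; apply: eq_bigr => v _; rewrite adjRE.
by rewrite expr2 mulrA -hu mulr_suml; apply: eq_bigr => v _; rewrite -mulrA [y u * _]mulrC.
Qed.

Lemma lambda_star_le_of_bound n (s : lift_space h n) (b : R) :
  (forall x l, new_eigenvector H s x l -> `|l| <= b) -> lambda_star_le (lift_adj H s) b.
Proof.
by move=> hb l /new_eig_eigenvector[x /hb] hl; apply/RleP; rewrite RabsE.
Qed.

End StandardReals.

(* [%Z] would otherwise denote the integers of ssrint. *)
Delimit Scope Z_scope with Z.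

(** [55696 = 236 ^ 2], which is below both constants of the theorem. *)
Lemma constant_le (c : Z) (t : Rdefinitions.R) : Z.le 55696 c -> Rle R0 t ->
  Rle (236%:R * 236%:R * t)%R (Rmult (IZR c) t).
Proof.
move=> hc t0.
have -> : (236%:R * 236%:R * t)%R = Rmult (Rmult (IZR 236) (IZR 236)) t.
  by rewrite -INRE INR_IZR_INZ.
rewrite -mult_IZR; apply: Rmult_le_compat_r => //.
by apply: IZR_le.
Qed.

Theorem theorem3 (h : nat) (H : rel 'I_h) :
  symmetric H -> irreflexive H -> (2 <= maxdeg H)%N ->
  exists N : nat, forall n : nat, (N <= n)%N ->
    Rge (prob (fun s : lift_space h n =>
               lambda_star_le (lift_adj H s)
                 (Rmult (IZR 430656%Z) (sqrt (INR (maxdeg H))))))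
        (Rminus R1 (Rpower (INR n)
                      (Ropp (Rmult (IZR 2%Z) (sqrt (INR (maxdeg H)))))))
    /\
    Rge (prob (fun s : lift_space h n =>
               exists S : {set 'I_h * 'I_n},
                 (#|S| <= h * maxdeg H)%N /\
                 exists mu : R, is_largest_eig (lift_adj H s) S mu /\
                   lambda_star_le (lift_adj H s) (Rmult (IZR 1189248%Z) mu)))
        (Rminus R1 (Rinv (pow (INR n) (h * maxdeg H)))).
Proof.
move=> Hsym Hirr Hdeg.
have [N1 hN1] := new_eigenvalue_bound Rdefinitions.R Hsym Hirr Hdeg.
have [N2 hN2] := new_eigenvalue_subgraph Rdefinitions.R Hsym Hirr Hdeg.
exists (N1 + N2).+1 => n hn.
have n0 : (0 < n)%N by apply: leq_trans hn.
have [B1 [cB1 hB1]] := hN1 n (leq_trans (leq_addr _ _) (ltnW hn)).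
have [B2 [cB2 hB2]] := hN2 n (leq_trans (leq_addl _ _) (ltnW hn)).
split; apply: Rle_ge.
  (* The bound obtained is [n ^ (- 2 Delta)]; it suffices because [sqrt Delta <= Delta]. *)
  apply: Rle_trans (_ : Rle (Rminus R1 (Rinv (pow (INR n) (2 * maxdeg H)))) _).
    apply: Rplus_le_compat_l; apply: Ropp_le_contravar.
    have nR : Rle R1 (INR n) by rewrite -[R1]/(INR 1); apply/le_INR/ssrnat.leP.
    have np : Rlt R0 (INR n) by apply: Rlt_le_trans nR; apply: Rlt_0_1.
    rewrite -Rpower_pow // -Rpower_Ropp.
    apply: Rle_Rpower => //; apply: Ropp_le_contravar.
    have -> : INR (2 * maxdeg H) = Rmult (IZR 2) (INR (maxdeg H)).
      by rewrite mult_INR [INR 2]INR_IZR_INZ.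
    apply: Rmult_le_compat_l; first by apply: Rlt_le; apply: Rlt_0_2.
    set D := INR _; have D1 : Rle R1 D.
      by rewrite -[R1]/(INR 1); apply/le_INR/ssrnat.leP; apply: ltnW.
    rewrite -{2}(sqrt_square D); last by apply: Rle_trans D1; apply: Rle_0_1.
    apply: sqrt_le_1_alt; rewrite -{1}(Rmult_1_l D).
    by apply: Rmult_le_compat_r => //; apply: Rle_trans D1; apply: Rle_0_1.
  apply/RleP; apply: prob_ge (lift_space_gt0 h n) _ _ => [s sB|].
    apply: lambda_star_le_of_bound => x l hx; apply: le_trans (hB1 s sB x l hx) _.
    rewrite RsqrtE INRE; apply/RleP; apply: constant_le; first by [].
    by apply/RleP; apply: sqrtr_ge0.
  by rewrite INRE RpowE; exact: cB1.
apply/RleP; apply: prob_ge (lift_space_gt0 h n) _ _ => [s sB|]; last first.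
  by rewrite INRE RpowE; exact: cB2.
have [S [mu [z [cS [z0 z1 z2] hmax hb]]]] := hB2 s sB.
exists S; split => //; exists mu; split; first exact: largest_eig_of_rayleigh z0 z1 z2 hmax.
apply: lambda_star_le_of_bound => x l hx; apply: le_trans (hb x l hx) _.
(* The sign of [mu] follows from the bound at hand, since [236^2 mu] dominates an absolute value. *)
have mu0 : (0 <= mu)%R.
  have := le_trans (normr_ge0 _) (hb x l hx); rewrite pmulr_rge0 //.
  by rewrite mulr_gt0.
by apply/RleP; apply: constant_le => //; apply/RleP.
Qed.
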